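(* Let $S$ be a countable (infinite) set with rates $c_{x,y}\in[0,+\infty)$, $x\ne y$ in $S$ (not necessarily symmetric), satisfying Assumption SEP, and let $\mathcal L$ be the infinitesimal generator of the simple exclusion process with rates $c_{x,y}$. Suppose that $$\mathbb E\big[|\mathcal C_{t,x}|\big]<+\infty\qquad\forall x\in S,\ \forall t\in\mathbb R_+,$$ $$\mathbb E\Big[\sum_{z\in\mathcal C_{t,x}}c^s_z\Big]<+\infty\qquad\forall x\in S,\ \forall t\in\mathbb R_+,$$ where $c^s_z:=\sum_{y\in S}c^s_{z,y}$ and $\mathcal C_{t,x}=\mathcal C_{t,x}(\mathcal K)$ is the random finite set defined in the context. Then the family $\mathcal C$ of local functions is a core for $\mathcal L$.
   Context: Setting. $S$ is a countable (infinite) set; $\mathcal E_S^o:=\{(x,y):x\ne y,\ x,y\in S\}$ (ordered pairs), $\mathcal E_S:=\{\{x,y\}:x\neq y,\ x,y\in S\}$ (unordered pairs). To each $(x,y)\in\mathcal E_S^o$ is associated $c_{x,y}\in[0,+\infty)$, not assumed symmetric; $c_{x,x}:=0$; $c^s_{x,y}:=c_{x,y}+c_{y,x}$. Under Assumption SEP below, $c^s_x=\sum_{y\in S}c^s_{x,y}$ is finite for all $x$. Path spaces. For a metric space $W$, $D_W=D(\mathbb R_+,W)$ is the space of càdlàg paths $\mathbb R_+=[0,+\infty)\to W$ with the Skorohod topology and its Borel $\sigma$-algebra. $\mathbb N=\{0,1,\dots\}$ is discrete; $\{0,1\}^S$ has the product topology. $D_{\mathbb N}^{\mathcal E_S^o}$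 has the product topology, with generic element $\mathcal K=(\mathcal K_{x,y})_{(x,y)\in\mathcal E_S^o}$. $\mathbb P$ (with expectation $\mathbb E$) is the law on $D_{\mathbb N}^{\mathcal E_S^o}$ of a family $(N_{x,y}(\cdot))_{(x,y)\in\mathcal E_S^o}$ of independent Poisson processes, $N_{x,y}$ having intensity $c_{x,y}$ and $N_{x,y}(0)=0$. For $\{x,y\}\in\mathcal E_S$, $\mathcal K^s_{x,y}(t):=\mathcal K_{x,y}(t)+\mathcal K_{y,x}(t)$. Assumption SEP: there exists $t_0>0$ such that for $\mathbb P$-a.a. $\mathcal K$ the undirected graph $\mathcal G_{t_0}(\mathcal K)$ with vertex set $S$ and edge set $\{\{x,y\}\in\mathcal E_S:\mathcal K^s_{x,y}(t_0)>\mathcal K^s_{x,y}(0)\}$ has only connected components of finite cardinality. Such a $t_0$ is fixed. For $r\in\mathbb N$, $\mathcal G^r_{t_0}(\mathcal K)$ is the graph with vertex set $S$ and edge set $\{\{x,y\}\in\mathcal E_S:\mathcal K^s_{x,y}((r+1)t_0)>\mathcal K^s_{x,y}(rt_0)\}$, and $\Gamma_r$ is the set of $\mathcal K$ for which $\mathcal G^r_{t_0}(\mathcal K)$ has only finite connected components. $\Gamma_*$ is the set of $\mathcal K\in D_{\mathbb N}^{\mathcal E_S^o}$ such that: (i) $\mathcal K\in\cap_{r\in\mathbb N}\Gamma_r$; (ii) $\sum_{y\in S\setminus\{x\}}\mathcal K^s_{x,y}(t)<+\infty$ for all $x\in S$, $t\in\mathbb R_+$; (iii) for $(x,y)\ne(x',y')$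 in $\mathcal E^o_S$ the sets of jump times of $\mathcal K_{x,y}$ and $\mathcal K_{x',y'}$ are disjoint, and all jumps equal $+1$; (iv) $\mathcal K_{x,y}(0)=0$ for all $(x,y)\in\mathcal E^o_S$. $\Gamma_*$ is Borel and $\mathbb P(\Gamma_* )=1$. Graphical construction. For $\mathcal K\in\Gamma_*$ and $\sigma\in\{0,1\}^S$ define $(\eta^\sigma_t[\mathcal K])_{t\ge0}$ iteratively: $\eta^\sigma_0[\mathcal K]:=\sigma$. If defined up to time $rt_0$, $r\in\mathbb N$, for each (finite) connected component $C$ of $\mathcal G^r_{t_0}(\mathcal K)$ let $s_1<\dots<s_k$ be the times $s\in(rt_0,(r+1)t_0]$ at which $\mathcal K_{x,y}(s)=\mathcal K_{x,y}(s-)+1$ for some $x\neq y$ in $C$. On $C$, start from $\eta^\sigma_{rt_0}[\mathcal K]$ and, successively at $s=s_1,\dots,s_k$, move a particle from $x$ to $y$ ($x\ne y$ in $C$) if just before time $s$ site $x$ is occupied and $y$ is empty, and $\mathcal K_{x,y}(s)=\mathcal K_{x,y}(s-)+1$ (at most one such pair exists); between these times the configuration on $C$ is constant. This defines $\eta^\sigma_t[\mathcal K]$ for $t\in(rt_0,(r+1)t_0]$. Semigroup and generator. $C(\{0,1\}^S)$ is the space of real continuous functions with the uniform norm. $S(t)f(\sigma):=\mathbb E[f(\eta^\sigma_t[\mathcal K])]$ defines a strongly continuous Markov semigroup on $C(\{0,1\}^S)$, the semigroup of the simple exclusion process (SEP) with rates $c_{x,y}$. Its generator $\mathcal L$ has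 domain $\mathcal D(\mathcal L)=\{f\in C(\{0,1\}^S): \lim_{t\downarrow0}(S(t)f-f)/t\text{ exists in }C(\{0,1\}^S)\}$ and $\mathcal L f$ is that limit. The sets $\mathcal C_{t,x}(\mathcal K)$. Given $x\in S$, $r\in\mathbb N$, $\mathcal K\in\Gamma_*$: let $C_0$ be the connected component of $x$ in $\mathcal G^r_{t_0}(\mathcal K)$ and, for $j=1,\dots,r$, let $C_j$ be the union over $y\in C_{j-1}$ of the connected components of $y$ in $\mathcal G^{r-j}_{t_0}(\mathcal K)$. Set $B_{r,x}(\mathcal K):=C_r$, $\mathcal C_{t,x}(\mathcal K):=B_{r,x}(\mathcal K)$ for $rt_0<t\le(r+1)t_0$, and $\mathcal C_{0,x}:=\{x\}$. A function $f:\{0,1\}^S\to\mathbb R$ is local if for some finite $A\subset S$, $f(\eta)$ is determined by $(\eta(x))_{x\in A}$. A set $\mathcal A$ is a core of $\mathcal L$ if $\mathcal A\subset\mathcal D(\mathcal L)$ and the graph of $\mathcal L$ in $C(\{0,1\}^S)\times C(\{0,1\}^S)$ is the closure of $\{(f,\mathcal L f):f\in\mathcal A\}$. *)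

(* Defs.v *)
From mathcomp Require Import all_boot all_order all_algebra.
From mathcomp Require Import finmap.
From mathcomp Require Import all_classical all_reals all_analysis.

Set Implicit Arguments.
Unset Strict Implicit.
Unset Printing Implicit Defensive.

Import Order.TTheory GRing.Theory Num.Theory.
Import numFieldNormedType.Exports.

Local Open Scope classical_set_scope.
Local Open Scope ring_scope.

(* Conventions.
   - Time is R : realType; a path indexed by [0, +oo) is a function on R of which
     only the values at nonnegative times are ever used.
   - A family (K_{x,y}) indexed by ordered pairs x != y of S is a function
     K : S -> S -> R -> nat of which only the off-diagonal entries are used.
   - The law of the Poisson family is carried by an arbitrary probability space
     Omega and a map N from Omega to families of cadlag paths: E[F(K)] is the
     integral of F (N w). Taking Omega to be the space of families of cadlag paths
     and N the identity gives the canonical setting. *)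

Definition cadlag (R : realType) (W : topologicalType) (f : R -> W) : Prop :=
  (forall t : R, 0 <= t -> f u @[u --> t^'+] --> f t) /\
  (forall t : R, 0 < t -> exists l : W, f u @[u --> t^'-] --> l).

Definition left_lim (R : realType) (f : R -> nat) (s : R) : nat :=
  lim (f u @[u --> s^'-]).

Definition jump_times (R : realType) (f : R -> nat) : set R :=
  [set s | 0 < s /\ f s <> left_lim f s].

Definition mutually_independent d (Omega : measurableType d) (R : realType)
    (P : probability Omega R) (I : choiceType) (D : set I)
    (F : I -> set (set Omega)) : Prop :=
  forall (J : {fset I}) (A : I -> set Omega),
    [set` J] `<=` D -> (forall i, i \in J -> F i (A i)) ->
    P (\bigcap_(i in [set` J]) A i) = (\prod_(i <- J) P (A i))%E.

(* Real-valued, so that truncated subtraction on nat is avoided. *)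
Definition increment (Omega : Type) (R : realType) (X : Omega -> R -> nat)
    (s t : R) (w : Omega) : R := (X w t)%:R - (X w s)%:R.

Definition process_sigma_algebra d (Omega : measurableType d) (R : realType)
    (X : Omega -> R -> nat) : set (set Omega) :=
  <<s [set A | exists t n, 0 <= t /\ A = [set w | X w t = n]] >>.

(* Poisson process of intensity lambda >= 0 with paths in D(R_+, nat). For
   lambda = 0 the increment law is the Dirac mass at 0, since 0 ^+ 0 = 1. *)
Definition poisson_process d (Omega : measurableType d) (R : realType)
    (P : probability Omega R) (lambda : R) (X : Omega -> R -> nat) : Prop :=
  [/\ forall w, cadlag (X w),
      forall t, 0 <= t -> measurable_fun setT (X ^~ t),
      {ae P, forall w, X w 0 = 0%N},
      forall s t (k : nat), 0 <= s -> s < t ->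
        P [set w | increment X s t w = k%:R] =
        ((lambda * (t - s)) ^+ k / k`!%:R * expR (- (lambda * (t - s))))%:E
    & forall (n : nat) (t : nat -> R), 0 <= t 0%N ->
        (forall i, t i < t i.+1) ->
        mutually_independent P [set: 'I_n]
          (fun i => preimage_set_system setT
                      (increment X (t i) (t i.+1)) measurable)].

Definition poisson_family d (Omega : measurableType d) (R : realType)
    (P : probability Omega R) (S : countType) (c : S -> S -> R)
    (N : Omega -> S -> S -> R -> nat) : Prop :=
  (forall x y, x != y -> poisson_process P (c x y) (fun w => N w x y)) /\
  mutually_independent P [set p : S * S | p.1 != p.2]
    (fun p => process_sigma_algebra (fun w => N w p.1 p.2)).

Section Graph.
Context (R : realType) (S : countType).
Variable t0 : R.
Implicit Types (K : S -> S -> R -> nat) (r : nat) (x y : S).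

Definition sym_path K x y (t : R) : nat := (K x y t + K y x t)%N.

Definition edge K r : rel S := fun x y =>
  (x != y) && (sym_path K x y (r%:R * t0) < sym_path K x y (r.+1%:R * t0))%N.

Definition component K r x : set S :=
  [set y | exists2 p : seq S, path (edge K r) x p & y = last x p].

Definition finite_components K r : Prop :=
  forall x, finite_set (component K r x).

Definition Gamma_star : set (S -> S -> R -> nat) :=
  [set K | [/\ forall r, finite_components K r,
    forall x t, 0 <= t ->
      ((\esum_(y in [set~ x]) (sym_path K x y t)%:R%:E : \bar R) < +oo)%E,
    forall x y x' y', x != y -> x' != y' -> (x, y) <> (x', y') ->
      jump_times (K x y) `&` jump_times (K x' y') = set0,
    forall x y s, x != y -> jump_times (K x y) s ->
      K x y s = (left_lim (K x y) s).+1
  & forall x y, x != y -> K x y 0 = 0%N]].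

Definition slab (t : R) : nat :=
  xget 0%N [set r : nat | r%:R * t0 < t <= r.+1%:R * t0].

Fixpoint backward_set K r x (j : nat) : set S :=
  if j is j'.+1
  then \bigcup_(y in backward_set K r x j') component K (r - j) y
  else component K r x.

(* The random set C_{t,x}. *)
Definition influence_set K (t : R) x : set S :=
  if t <= 0 then [set x] else backward_set K (slab t) x (slab t).

Local Notation config := {ptws S -> bool}.

Definition jumps_up K (s : R) x y : Prop :=
  x != y /\ K x y s = (left_lim (K x y) s).+1.

Definition update_times K (C : set S) (a b : R) : seq R :=
  sort <=%O (fset_set [set s : R | a < s <= b /\
    exists x y, [/\ C x, C y & jumps_up K s x y]]).

Definition move (eta : config) x y : config :=
  fun z => if z == x then false else if z == y then true else eta z.

Definition admissible K (C : set S) (s : R) (eta : config) (p : S * S) : Prop :=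
  [/\ C p.1, C p.2, jumps_up K s p.1 p.2, eta p.1 & ~~ eta p.2].

Definition update K (C : set S) (eta : config) (s : R) : config :=
  if pselect (exists p, admissible K C s eta p) is left h
  then move eta (projT1 (cid h)).1 (projT1 (cid h)).2
  else eta.

(* Configuration at time t in (r t0, (r + 1) t0] when it is zeta at time r t0;
   the value at z is determined by the component of z alone *)
Definition evolve K r (zeta : config) (t : R) : config := fun z =>
  foldl (update K (component K r z)) zeta
        (update_times K (component K r z) (r%:R * t0) t) z.

Fixpoint eta_grid K (sigma : config) r : config :=
  if r is r'.+1 then evolve K r' (eta_grid K sigma r') (r%:R * t0) else sigma.

Definition eta K (sigma : config) (t : R) : config :=
  if t <= 0 then sigma
  else evolve K (slab t) (eta_grid K sigma (slab t)) t.

End Graph.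

Notation config S := {ptws S -> bool}.

Section Semigroup.
Context d (Omega : measurableType d) (R : realType) (P : probability Omega R).
Context (S : countType).
Variables (N : Omega -> S -> S -> R -> nat) (t0 : R).

(* Expectations run over this event, of probability 1, since eta and the sets
   influence_set are meaningful only on Gamma_star. *)
Definition graphical_event : set Omega := [set w | Gamma_star t0 (N w)].

Definition semigroup (t : R) (f : config S -> R) (sigma : config S) : R :=
  \int[P]_(w in graphical_event) f (eta t0 (N w) sigma t).

(* Graph of the generator: f is in its domain and L f = g. *)
Definition generator (f g : config S -> R) : Prop :=
  [/\ continuous f, continuous g &
      (fun sigma => (semigroup t f sigma - f sigma) / t) @[t --> 0^'+]
        --> (g : {uniform config S -> R})].

End Semigroup.

(* For X compact, the closure in C(X) x C(X) is the trace on it of the closure in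
   {uniform X -> R} x {uniform X -> R}. *)
Definition is_core (R : realType) (X : topologicalType)
    (L : (X -> R) -> (X -> R) -> Prop) (A : set (X -> R)) : Prop :=
  (forall f, A f -> exists g, L f g) /\
  [set fg : {uniform X -> R} * {uniform X -> R} | L fg.1 fg.2] =
  closure [set fg : {uniform X -> R} * {uniform X -> R} | A fg.1 /\ L fg.1 fg.2]
  `&` [set fg | continuous (fg.1 : X -> R) /\ continuous (fg.2 : X -> R)].

Definition local_functions (R : realType) (S : countType) : set (config S -> R) :=
  [set f | exists A : {fset S}, forall eta eta' : config S,
     (forall x, x \in A -> eta x = eta' x) -> f eta = f eta'].

Definition total_rate (R : realType) (S : countType) (c : S -> S -> R) (z : S)
  : \bar R := (\esum_(y in [set: S]) (c z y + c y z)%:E)%E.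

(* Main.v *)
Require Import Defs.
From mathcomp Require Import all_boot all_order all_algebra.
From mathcomp Require Import finmap.
From mathcomp Require Import all_classical all_reals all_analysis.
From mathcomp Require Import measurable_realfun ring lra.

Set Implicit Arguments.
Unset Strict Implicit.
Unset Printing Implicit Defensive.

Import Order.TTheory GRing.Theory Num.Theory.
Import numFieldNormedType.Exports.

Local Open Scope classical_set_scope.
Local Open Scope ring_scope.

(** Write [L] for the generator and, for a finite set [Q] of ordered pairs, let
    [gen_on Q] be the generator of the exclusion process in which only the pairs of
    [Q] exchange particles. Closeness below always means uniform closeness. Since
    [L f] is the limit at time [0] of difference quotients, only times [t <= t0]
    matter, and for these the graphical construction uses nothing but the first
    slab and its graph of clusters.

    Cut [[0, t]] into [M] cells of length [h] and keep only the jumps of [Q]. A cell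
    in which one pair jumps once and the others are still acts on a configuration
    by one exchange; let every other cell act by the identity. Independence makes
    the expectation over one cell the operator [average Q (cell_rate c Q h)], which
    is exactly [id + h * exp (- h * total c Q) * gen_on Q], and the expectation over
    [i] cells its [i]-th iterate ([chain_expectation]). When all cells have at most
    one jump and the clusters of the sites read by a local [f] lie within the sites
    of [Q], the discrete dynamics and the graphical construction agree on these
    sites ([graphical_chain]). The exceptional probability vanishes as [M], then
    [Q], grow, so the iterates converge to the semigroup on local functions
    ([semigroup_scheme]).

    Integrability of the rates enters through influence. Changing the configuration
    at the ends of a pair [p] can change an iterate of [f] only if one of them lies
    in the cluster of a site read by [f]; so the oscillation of every iterate along
    [p] is at most [2 * sup f * sensitivity A p] ([influence_bound]), a bound free
    of [Q], [M] and [i], and the sum of [c p * sensitivity A p] is at most the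
    expected total rate of the clusters ([energy_bounded]). Hence [gen_on (pairs S n)]
    converges, uniformly over all these iterates, to an operator [full_gen].

    Two consequences give the theorem. A short run of the scheme from a local
    function [f] changes [f] at a rate close to [full_gen f]; with contractivity of
    the semigroup this shows that every limit of pairs [(f, full_gen f)] with [f]
    local lies in the graph of [L] ([generator_of_approx]), in particular that local
    functions are in the domain, with [L f = full_gen f]. Conversely let [g] be in
    the domain of [L], choose [f] local and close to [g], and average the iterates of
    [f] over a short time [t]. The mean [u] is local, close to [g], and telescoping
    makes [gen_on Q u] essentially the increment of the scheme divided by [t], hence
    close to [(S(t) g - g) / t] and so to [L g]; the influence bound allows
    [gen_on Q] to be replaced by [full_gen] ([approx_of_generator]).

    Two facts are used throughout: almost every family of paths is in
    [Gamma_star] ([ae_Gamma_star]), where finiteness of the clusters is carried from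
    the first slab to the others by stationarity; and integrals over the graphical
    event are integrals over a measurable subset of full probability
    ([integral_full_subset]). *)


(** * Integrals over sets that need not be measurable *)

Section MeasureTools.
Context d (T : measurableType d) (R : realType).
Variable mu : probability T R.
Implicit Types (D G : set T).

Lemma ae_measurable_core (Q : T -> Prop) : {ae mu, forall x, Q x} ->
  exists D, [/\ measurable D, mu (~` D) = 0%E & forall x, D x -> Q x].
Proof.
move=> [B [mB B0 sub]]; exists (~` B); split.
- exact: measurableC.
- by rewrite setCK.
- by move=> x nB; apply: contrapT => nQ; apply: nB; apply: sub.
Qed.

Import HBNNSimple.

(** The integral of a nonnegative function is a supremum over measurable simple
    functions below it, and each of these can be cut down to [D] at no cost,
    whether or not [F] is measurable. *)
Lemma ge0_integral_full (F : T -> \bar R) D : measurable D ->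
  mu (~` D) = 0%E -> (forall x, (0 <= F x)%E) ->
  (\int[mu]_x F x = \int[mu]_x (F \_ D) x)%E.
Proof.
move=> mD D0 F0.
have FD0 x : (0 <= (F \_ D) x)%E by rewrite /patch; case: ifP.
rewrite !ge0_integralTE//; apply/eqP; rewrite eq_le; apply/andP; split; last first.
  apply: le_ereal_sup => _ [h hle <-]; exists h => // x.
  apply: le_trans (hle x) _; rewrite /patch; case: ifP => // _; exact: F0.
apply: ge_ereal_sup => _ [h hle <-].
have mh E : measurable_fun E (EFin \o (h : T -> R)).
  by apply/measurable_EFinP; apply: measurable_funTS; exact: measurable_funPT.
have -> : sintegral mu h = (\int[mu]_(x in D) (h x)%:E)%E.
  rewrite -integralT_nnsfun (ge0_negligible_integral (measurableC mD))//.
    by rewrite setTD setCK.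
  by move=> x _; rewrite lee_fin.
rewrite integral_mkcond ge0_integralTE; last first.
  by move=> x; rewrite /patch; case: ifP; rewrite ?lee_fin.
apply: le_ereal_sup => _ [g gle <-]; exists g => // x.
apply: le_trans (gle x) _; rewrite /patch; case: ifP => // _; exact: hle.
Qed.

(** The set [G] is arbitrary: integrals over an event known only to contain a
    measurable set of full probability are computed on that set. *)
Lemma integral_full_subset (F : T -> \bar R) D G : measurable D ->
  mu (~` D) = 0%E -> D `<=` G ->
  (\int[mu]_(x in G) F x = \int[mu]_(x in D) F x)%E.
Proof.
move=> mD D0 DG.
have res (h : T -> \bar R) : h \_ G \_ D = h \_ D.
  by rewrite -patch_setI; congr (_ \_ _); apply: setIidl.
rewrite !(integralE mu _ F); congr (_ - _)%E; rewrite integral_mkcond [RHS]integral_mkcond.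
all: rewrite (ge0_integral_full mD D0) ?res// => x;
  by rewrite /patch; case: ifP => _ //; rewrite ?funepos_ge0 ?funeneg_ge0.
Qed.

Lemma Rintegral_full_subset (f : T -> R) D G : measurable D ->
  mu (~` D) = 0%E -> D `<=` G ->
  \int[mu]_(x in G) f x = \int[mu]_(x in D) f x.
Proof. by move=> mD D0 DG; rewrite /Rintegral (integral_full_subset _ mD D0 DG). Qed.

(** Monotonicity of lower integrals, used for dominating functions such as
    infinite sums over clusters. *)
Lemma le_ge0_integral (F H : T -> \bar R) D :
  (forall x, D x -> (0 <= F x)%E) -> (forall x, D x -> (F x <= H x)%E) ->
  (\int[mu]_(x in D) F x <= \int[mu]_(x in D) H x)%E.
Proof.
move=> F0 FH.
have FD0 x : (0 <= (F \_ D) x)%E.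
  by rewrite /patch; case: ifP => //; rewrite inE => /F0.
have FHD x : ((F \_ D) x <= (H \_ D) x)%E.
  by rewrite /patch; case: ifP => //; rewrite inE => /FH.
rewrite integral_mkcond [leRHS]integral_mkcond !ge0_integralTE//.
  by apply: le_ereal_sup => _ [g gle <-]; exists g => // x; apply: le_trans (gle x) _.
by move=> x; apply: le_trans (FHD x).
Qed.

Lemma bounded_integrable (f : T -> R) D (M : R) : measurable D ->
  measurable_fun D f -> (forall x, D x -> `|f x| <= M) ->
  mu.-integrable D (EFin \o f).
Proof.
move=> mD mf fM; apply: measurable_bounded_integrable => //.
  by apply: le_lt_trans (probability_le1 mu mD) _; rewrite ltry.
exists M; split; first exact: num_real.
by move=> x Mx t Dt /=; apply: le_trans (fM _ Dt) (ltW Mx).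
Qed.

Lemma ae_forall_countable (I : countType) (Q : I -> T -> Prop) :
  (forall i, {ae mu, forall x, Q i x}) -> {ae mu, forall x, forall i, Q i x}.
Proof.
move=> h.
have : {ae mu, forall x, forall n : nat, if @choice.unpickle I n is Some i then Q i x else True}.
  apply: ae_foralln => n; case: choice.unpickle => [i|]; first exact: h.
  exact: aeW.
apply: filterS => x hx i; have := hx (choice.pickle i); by rewrite choice.pickleK.
Qed.

End MeasureTools.

(** * Exchanges and the averaging operator *)

Section Hop.
Context (R : realType) (S : countType).
Implicit Types (s : config S) (p : S * S) (Q : {fset S * S}).

Definition hop p s : config S :=
  if s p.1 && ~~ s p.2 then move s p.1 p.2 else s.

Lemma hop_off p s x : x != p.1 -> x != p.2 -> hop p s x = s x.
Proof.
by move=> x1 x2; rewrite /hop /move; case: ifP => // _; rewrite (negbTE x1) (negbTE x2).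
Qed.

Lemma hop_local p s s' (D : set S) : D p.1 -> D p.2 ->
  (forall x, D x -> s x = s' x) -> forall x, D x -> hop p s x = hop p s' x.
Proof.
move=> D1 D2 ss' x Dx; rewrite /hop (ss' _ D1) (ss' _ D2) /move.
by case: ifP => _; rewrite ss'.
Qed.

(** A step of the Markov chain that performs the exchange [p] with probability
    [q p] and stays put with the remaining probability. *)
Definition average Q (q : S * S -> R) (g : config S -> R) : config S -> R :=
  fun s => g s + \sum_(p <- Q) q p * (g (hop p s) - g s).

Definition gen_on Q (c : S -> S -> R) (g : config S -> R) : config S -> R :=
  fun s => \sum_(p <- Q) c p.1 p.2 * (g (hop p s) - g s).

Section Average.
Variables (Q : {fset S * S}) (q : S * S -> R).

Lemma averageD g g' : average Q q (fun s => g s + g' s) =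
  fun s => average Q q g s + average Q q g' s.
Proof.
apply/funext => s; rewrite /average /= [RHS]addrACA; congr (_ + _); rewrite -big_split; by apply: eq_bigr => p _ /=; ring.
Qed.

Lemma averageZ (a : R) g : average Q q (fun s => a * g s) =
  fun s => a * average Q q g s.
Proof.
apply/funext => s; rewrite /average mulrDr; congr (_ + _); rewrite mulr_sumr.
by apply: eq_bigr => p _; ring.
Qed.

Lemma average0 : average Q q (fun=> 0) = fun=> 0.
Proof. by apply/funext => s; rewrite /average big1 ?addr0// => p _; rewrite subrr mulr0. Qed.

Hypothesis q0 : forall p, 0 <= q p.
Hypothesis q1 : \sum_(p <- Q) q p <= 1.

(** A substochastic [q] makes [average] a convex combination of values of [g]. *)
Lemma average_le g (M : R) : (forall s, `|g s| <= M) ->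
  forall s, `|average Q q g s| <= M.
Proof.
move=> gM s; rewrite /average.
have -> : g s + \sum_(p <- Q) q p * (g (hop p s) - g s) =
    (1 - \sum_(p <- Q) q p) * g s + \sum_(p <- Q) q p * g (hop p s).
  rewrite mulrBl mul1r -addrA; congr (_ + _); rewrite addrC mulr_suml -sumrB.
  by apply: eq_bigr => p _; ring.
apply: le_trans (ler_normD _ _) _.
have -> : M = (1 - \sum_(p <- Q) q p) * M + \sum_(p <- Q) q p * M.
  by rewrite -mulr_suml -mulrDl subrK mul1r.
apply: lerD.
  by rewrite normrM ger0_norm ?subr_ge0// ler_wpM2l ?subr_ge0.
apply: le_trans (ler_norm_sum _ _ _) _; apply: ler_sum => p _.
by rewrite normrM ger0_norm// ler_wpM2l.
Qed.

Lemma iter_average_le n g (M : R) : (forall s, `|g s| <= M) ->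
  forall s, `|iter n (average Q q) g s| <= M.
Proof. by move=> gM; elim: n => //= n IH; apply: average_le. Qed.

End Average.
End Hop.

(** * Counting paths and their jumps *)

Section Paths.
Context (R : realType).
Implicit Types (f : R -> nat) (s t a b u : R).

Definition mono f := forall s t, 0 <= s -> s <= t -> (f s <= f t)%N.

Lemma left_lim_near f s : cadlag f -> 0 < s ->
  \forall u \near s^'-, f u = left_lim f s.
Proof.
move=> [_ /(_ s)] h s0; have [l fl] := h s0.
have -> : left_lim f s = l by apply: cvg_lim fl; exact: discrete_hausdorff.
have : nbhs l [set l] by rewrite nbhs_principalE; exact/principal_filterP.
by move=> /fl; rewrite nbhs_simpl.
Qed.

(** A path with discrete values takes the value of its left limit at times
    arbitrarily close on the left. *)
Lemma left_lim_eventually f s a : cadlag f -> 0 < s -> a < s ->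
  exists2 u, a < u < s & f u = left_lim f s.
Proof.
move=> cf s0 las.
have : \forall u \near s^'-, f u = left_lim f s /\ a < u /\ u < s.
  near=> u; split; last split.
  - by near: u; exact: (left_lim_near cf s0).
  - by near: u; apply: nbhs_left_gt.
  - by near: u; apply: nbhs_left_lt.
move=> /(@filter_ex _ _ (at_left_proper_filter s)) [u [fu [au us]]]; exists u; last exact: fu.
by rewrite au us.
Unshelve. all: by end_near. Qed.

Lemma left_lim_ge f s a : cadlag f -> mono f -> 0 <= a -> a < s ->
  (f a <= left_lim f s)%N.
Proof.
move=> cf mf a0 las; have s0 : 0 < s by apply: le_lt_trans las.
have [u /andP[lau _] <-] := left_lim_eventually cf s0 las.
by apply: mf => //; apply: ltW.
Qed.

Lemma left_lim_le f s : cadlag f -> mono f -> 0 < s -> (left_lim f s <= f s)%N.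
Proof.
move=> cf mf s0; have [u /andP[lau us] <-] := left_lim_eventually cf s0 s0.
by apply: mf; apply: ltW.
Qed.

Lemma right_constant f t : cadlag f -> 0 <= t ->
  exists2 e, 0 < e & forall u, t <= u -> u < t + e -> f u = f t.
Proof.
move=> [cf _] t0.
have : nbhs (f t) [set f t] by rewrite nbhs_principalE; exact/principal_filterP.
move=> /(cf _ t0) [e /= e0 he]; exists e => // u.
rewrite le_eqVlt => /orP[/eqP <- //|tu] ute; apply: he => //=.
by rewrite ltr0_norm ?subr_lt0// opprB ltrBlDl.
Qed.

(** The jump time is the infimum of the times at which the path has moved;
    right-continuity puts it inside that set. *)
Lemma unit_increment_jump f a b : cadlag f -> mono f -> 0 <= a ->
  a < b -> f b = (f a).+1 ->
  exists s, [/\ a < s <= b, left_lim f s = f a & f s = (f a).+1].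
Proof.
move=> cf mf a0 ab fb.
pose A := [set u | a <= u /\ f u = (f a).+1].
have Ab : A b by split => //; apply: ltW.
have hA : has_inf A by split; [exists b|exists a => u []].
pose s := inf A.
have sb : s <= b by apply: ge_inf => //; case: hA.
have as_ : a <= s by apply: lb_le_inf; [exists b|move=> u []].
have below u : a <= u -> u < s -> f u = f a.
  move=> au us; apply/eqP; rewrite eqn_leq [X in _ && X]mf// andbT.
  have /mf : 0 <= u by apply: le_trans au.
  move=> /(_ b (ltW (lt_le_trans us sb))); rewrite fb leq_eqVlt ltnS => /orP[/eqP fu|//].
  have : s <= u by apply: ge_inf; [case: hA|split].
  by rewrite leNgt us.
have fs : f s = (f a).+1.
  have [e e0 he] := right_constant cf (le_trans a0 as_).
  have [u [au fu] use] := inf_adherent e0 hA.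
  rewrite -(he u) //; apply: ge_inf; [by case: hA|by split].
have las : a < s.
  by rewrite lt_neqAle as_ andbT; apply/eqP => E; move: fs; rewrite -E => /eqP; rewrite (ltn_eqF (ltnSn _)).
exists s; split => //; first by rewrite las.
have s0 : 0 < s by apply: le_lt_trans las.
have [u /andP[au us] <-] := left_lim_eventually cf s0 las.
by apply: below => //; apply: ltW.
Qed.

End Paths.

(** * The graphical construction read on a time grid *)

Section Chain.
Context (R : realType) (S : countType).
Implicit Types (K : S -> S -> R -> nat) (Q : {fset S * S}) (p : S * S)
  (s : config S) (a b h t : R).

Definition quiet K Q a b := forall p, p \in Q -> K p.1 p.2 b = K p.1 p.2 a.

Definition single K Q a b p :=
  [/\ p \in Q, K p.1 p.2 b = (K p.1 p.2 a).+1 &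
      forall p', p' \in Q -> p' != p -> K p'.1 p'.2 b = K p'.1 p'.2 a].

(** A cell that is neither [quiet] nor [single] acts as the identity. Its true effect
    is irrelevant in the limit, and this choice makes the mean of a cell an exact
    [average]. *)
Definition cell_map K Q a b s : config S :=
  if pselect (exists p, single K Q a b p) is left e then hop (projT1 (cid e)) s
  else s.

Lemma single_inj K Q a b p p' : single K Q a b p -> single K Q a b p' -> p = p'.
Proof.
move=> [pQ Kp _] [_ _ /(_ p pQ) h]; apply/eqP; apply: contrapT => /negP /h.
by rewrite Kp => /eqP; rewrite gtn_eqF.
Qed.

Lemma cell_map_single K Q a b p s : single K Q a b p ->
  cell_map K Q a b s = hop p s.
Proof.
move=> sp; rewrite /cell_map; case: pselect => [e|[]]; last by exists p.
by case: cid => /= q /single_inj /(_ sp) ->.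
Qed.

Lemma cell_map_none K Q a b s : ~ (exists p, single K Q a b p) ->
  cell_map K Q a b s = s.
Proof. by rewrite /cell_map; case: pselect. Qed.

Fixpoint chain K Q h (i : nat) s : config S :=
  if i is i'.+1 then cell_map K Q (i'%:R * h) (i%:R * h) (chain K Q h i' s)
  else s.

Definition cells_ok K Q h (m : nat) := forall i, (i < m)%N ->
  quiet K Q (i%:R * h) (i.+1%:R * h) \/
  exists p, single K Q (i%:R * h) (i.+1%:R * h) p.

Definition jump_set K (C : set S) a b := [set u : R | a < u <= b /\
    exists x y, [/\ C x, C y & jumps_up K u x y]].

(** Update times are processed in increasing order, so one more jump in a later cell
    is appended to the list. *)
Lemma sort_fset_set_rcons (A : set R) (u : R) : finite_set A ->
  (forall v, A v -> v < u) ->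
  sort <=%O (fset_set (A `|` [set u])) = rcons (sort <=%O (fset_set A)) u.
Proof.
move=> fA Au.
have fAu : finite_set (A `|` [set u]) by rewrite finite_setU; split.
apply: lt_sorted_eq.
- by rewrite sort_lt_sorted fset_uniq.
- rewrite lt_sorted_pairwise pairwise_rcons -lt_sorted_pairwise sort_lt_sorted fset_uniq andbT.
  apply/allP => v; rewrite mem_sort in_fset_set// inE; exact: Au.
- move=> v; rewrite mem_sort mem_rcons in_cons mem_sort !in_fset_set//.
  apply/idP/idP => [/set_mem[Av|->]|/orP[/eqP->|/set_mem Av]].
  - by rewrite (mem_set Av) orbT.
  - by rewrite eqxx.
  - by apply/mem_set; right.
  - by apply/mem_set; left.
Qed.

Section Graphical.
Variables (K : S -> S -> R -> nat) (Q : {fset S * S}) (C : set S).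
Hypothesis Kmono : forall x y, x != y -> mono (K x y).
Hypothesis Kcadlag : forall x y, x != y -> cadlag (K x y).
Hypothesis Qoff : forall p, p \in Q -> p.1 != p.2.
Hypothesis CQ : forall x y, C x -> C y -> x != y -> (x, y) \in Q.

Lemma jumps_up_constant a b u p : p.1 != p.2 -> 0 <= a -> a < u <= b ->
  K p.1 p.2 b = K p.1 p.2 a -> ~ jumps_up K u p.1 p.2.
Proof.
move=> pne a0 /andP[au ub] Kab [_ Ku].
have := left_lim_ge (Kcadlag pne) (Kmono pne) a0 au.
have /(_ _ ub) := Kmono pne (ltW (le_lt_trans a0 au)).
by rewrite Kab Ku => h1 h2; have := leq_trans h1 h2; rewrite ltnn.
Qed.

Lemma jumps_up_single a b p : 0 <= a -> a < b -> single K Q a b p ->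
  exists u, [/\ a < u <= b, jumps_up K u p.1 p.2 &
    forall q v, q \in Q -> a < v <= b -> jumps_up K v q.1 q.2 -> q = p /\ v = u].
Proof.
move=> a0 ab [pQ Kp Kother]; have pne := Qoff pQ.
have [u [aub llu Ku]] := unit_increment_jump (Kcadlag pne) (Kmono pne) a0 ab Kp.
exists u; split => //; first by split; rewrite // Ku llu.
move=> q v qQ avb jv; have [qp|qp] := eqVneq q p; last first.
  by have := jumps_up_constant (Qoff qQ) a0 avb (Kother _ qQ qp).
split => //; rewrite qp in jv; move: jv => [_ Kv].
case/andP: avb aub => av vb /andP[au ub].
have [vu|uv|//] := ltgtP v u.
- have h1 := left_lim_ge (Kcadlag pne) (Kmono pne) (ltW (le_lt_trans a0 av)) vu.
  have h2 := left_lim_ge (Kcadlag pne) (Kmono pne) a0 av.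
  by move: h1; rewrite Kv llu ltnNge h2.
- have h1 := left_lim_ge (Kcadlag pne) (Kmono pne) (ltW (le_lt_trans a0 au)) uv.
  have h2 := Kmono pne (ltW (le_lt_trans a0 av)) vb.
  by move: h2; rewrite Kv Kp ltnS leqNgt -Ku h1.
Qed.

Lemma update_at_jump u p (eta : config S) : p \in Q -> C p.1 -> C p.2 ->
  jumps_up K u p.1 p.2 ->
  (forall q, q \in Q -> jumps_up K u q.1 q.2 -> q = p) ->
  update K C eta u = hop p eta.
Proof.
move=> pQ C1 C2 jp uniq_; rewrite /update; case: pselect => [e|ne].
  case: cid => q /= [q1 q2 jq e1 e2].
  have qQ : (q.1, q.2) \in Q by apply: CQ => //; case: jq.
  rewrite -surjective_pairing in qQ.
  by rewrite -(uniq_ _ qQ jq) /hop e1 e2.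
by rewrite /hop; case: ifP => // /andP[e1 e2]; case: ne; exists p.
Qed.

(** A set [C] closed under the edges that are open before the final time is updated
    autonomously. Cell by cell, either the jumping pair lies in [C], and both
    dynamics perform its exchange, or it lies outside [C], and neither changes [C].
    Finiteness of the set of update times is part of the induction because
    [update_times] is meaningless without it. *)
Lemma graphical_chain h (m : nat) (zeta : config S) : 0 < h -> cells_ok K Q h m ->
  (forall x y, x != y -> (K x y 0 < K x y (m%:R * h))%N -> C x <-> C y) ->
  forall i, (i <= m)%N -> finite_set (jump_set K C 0 (i%:R * h)) /\
  forall x, C x ->
  foldl (update K C) zeta (update_times K C 0 (i%:R * h)) x = chain K Q h i zeta x.
Proof.
move=> h0 ok Cedge; elim=> [|i IH] im.
  have -> : jump_set K C 0 (0%:R * h) = set0.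
    rewrite -subset0 => u [/andP[]]; rewrite mul0r => u0 /(lt_le_trans u0).
    by rewrite ltxx.
  split=> // x _ /=; rewrite /update_times (_ : [set _ | _] = set0) ?fset_set0//.
  rewrite -subset0 => u [/andP[]]; rewrite mul0r => u0 /(lt_le_trans u0).
  by rewrite ltxx.
have [fin IHx] := IH (ltnW im).
have a0 : 0 <= i%:R * h by rewrite mulr_ge0// ltW.
have ab : i%:R * h < i.+1%:R * h by rewrite ltr_pM2r// ltr_nat.
set a := i%:R * h in a0 ab fin IHx *; set b := i.+1%:R * h in ab *.
have ok_i : quiet K Q a b \/ exists p, single K Q a b p by apply: ok.
have bm : b <= m%:R * h by rewrite ler_pM2r// ler_nat.
have splitJ : jump_set K C 0 b = jump_set K C 0 a `|` jump_set K C a b.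
  apply/seteqP; split=> u.
    move=> [/andP[u0 ub] J]; have [ua|au] := leP u a; [left|right]; split => //.
    - by rewrite u0.
    - by rewrite au.
  move=> [[/andP[u0 ua] J]|[/andP[au ub] J]]; split => //.
  - by rewrite u0 (le_trans ua (ltW ab)).
  - by rewrite ub (le_lt_trans a0 au).
have chainE : chain K Q h i.+1 zeta = cell_map K Q a b (chain K Q h i zeta) by [].
have noJ : jump_set K C a b = set0 ->
    (forall x, C x -> chain K Q h i.+1 zeta x = chain K Q h i zeta x) ->
    finite_set (jump_set K C 0 b) /\ forall x, C x ->
    foldl (update K C) zeta (update_times K C 0 b) x = chain K Q h i.+1 zeta x.
  move=> J0 same; rewrite splitJ J0 setU0; split => // x Cx.
  by rewrite same// -IHx// /update_times -!/(jump_set _ _ _ _) splitJ J0 setU0.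
case: ok_i => [q|[p sp]].
  apply: noJ => [|x _].
    rewrite -subset0 => u [uab [x [y [Cx Cy jx]]]].
    have xy : (x, y) \in Q by apply: CQ => //; case: jx.
    by have := @jumps_up_constant a b u (x, y) (Qoff xy) a0 uab (q _ xy).
  rewrite chainE cell_map_none// => -[p [pQ]].
  by rewrite (q _ pQ) => /eqP; rewrite ltn_eqF.
have [u [uab ju uniq_u]] := jumps_up_single a0 ab sp.
have [pQ Kp Kother] := sp; have pne := Qoff pQ.
have C12 : C p.1 <-> C p.2.
  apply: Cedge => //; apply: leq_ltn_trans (Kmono pne (lexx 0) a0) _.
  have := Kmono pne (le_trans a0 (ltW ab)) bm.
  by apply: leq_trans; rewrite Kp.
have [C1|nC1] := pselect (C p.1).
  have C2 := C12.1 C1.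
  have J1 : jump_set K C a b = [set u].
    apply/seteqP; split=> v.
      move=> [vab [x [y [Cx Cy jx]]]].
      have xy : (x, y) \in Q by apply: CQ => //; case: jx.
      by have [] := uniq_u (x, y) v xy vab jx.
    by move=> ->; split => //; exists p.1, p.2.
  have ltu v : jump_set K C 0 a v -> v < u.
    move=> [/andP[_ va] _]; apply: le_lt_trans va _; by case/andP: uab.
  split; first by rewrite splitJ J1 finite_setU; split.
  move=> x Cx; rewrite /update_times -/(jump_set _ _ _ _) splitJ J1.
  rewrite sort_fset_set_rcons// foldl_rcons chainE (cell_map_single _ sp).
  rewrite (@update_at_jump u p)//; last by move=> q qQ jq; have [] := uniq_u _ _ qQ uab jq.
  apply: (@hop_local _ p _ _ C) => // y Cy; exact: IHx.
have nC2 : ~ C p.2 by move=> /(C12.2).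
apply: noJ => [|x Cx].
  rewrite -subset0 => v [vab [x [y [Cx Cy jx]]]].
  have xy : (x, y) \in Q by apply: CQ => //; case: jx.
  by have [E _] := uniq_u (x, y) v xy vab jx; apply: nC1; rewrite -E.
rewrite chainE (cell_map_single _ sp) hop_off//.
- by apply/eqP => E; apply: nC1; rewrite -E.
- by apply/eqP => E; apply: nC2; rewrite -E.
Qed.

End Graphical.
End Chain.

(** * Clusters of the percolation graph *)

Section Components.
Context (R : realType) (S : countType).
Variable t0 : R.
Implicit Types (K : S -> S -> R -> nat) (x y z : S).

Lemma edge_sym K r : symmetric (edge t0 K r).
Proof. by move=> x y; rewrite /edge eq_sym /sym_path addnC [X in (_ < X)%N]addnC. Qed.

Lemma component_refl K r x : component t0 K r x x.
Proof. by exists [::]. Qed.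

Lemma component_edge K r x y z : component t0 K r x y -> edge t0 K r y z ->
  component t0 K r x z.
Proof.
by move=> [p px ->] e; exists (rcons p z); rewrite ?rcons_path ?px ?last_rcons.
Qed.

Lemma component_edge_iff K r x y z : edge t0 K r y z ->
  component t0 K r x y <-> component t0 K r x z.
Proof.
by move=> e; split=> /component_edge; [exact|apply; rewrite edge_sym].
Qed.

Lemma component_sub_closed K r x (B : set S) : B x ->
  (forall y z, B y -> edge t0 K r y z -> B z) -> component t0 K r x `<=` B.
Proof.
move=> Bx Bcl _ [p px ->]; elim: p x Bx px => //= y p IH x Bx /andP[e py].
by apply: IH => //; apply: Bcl e.
Qed.

(** Finiteness of the clusters in terms of countably many edges: each site lies in a
    finite set with no edge across its boundary. *)
Lemma finite_components_closed K r : finite_components t0 K r <->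
  forall x, exists B : {fset S}, x \in B /\
    forall y z, y \in B -> z \notin B -> ~~ edge t0 K r y z.
Proof.
split=> h x.
  exists (fset_set (component t0 K r x)).
  rewrite in_fset_set//; split; first by apply/mem_set; exact: component_refl.
  move=> y z; rewrite !in_fset_set// => /set_mem Cy /negP nCz; apply/negP => e.
  by apply: nCz; apply/mem_set; apply: component_edge e.
have [B [xB Bcl]] := h x.
apply: (@sub_finite_set _ _ [set` B]) => //.
apply: component_sub_closed => //= y z yB e; apply: contraTT e => zB; exact: Bcl zB.
Qed.

Lemma slab_first t : 0 < t -> t <= t0 -> slab t0 t = 0%N.
Proof.
move=> t_gt0 tt0; have t0_gt0 := lt_le_trans t_gt0 tt0.
pose A := [set r : nat | r%:R * t0 < t <= r.+1%:R * t0].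
have : A (slab t0 t).
  by apply: (@xgetI _ _ A 0%N); rewrite /A /= mul0r mul1r t_gt0.
case: (slab t0 t) => // r /andP[/lt_le_trans /(_ tt0) + _].
by rewrite gtr_pMl// ltNge ler1n.
Qed.

Lemma influence_set_first K x : 0 < t0 -> influence_set t0 K t0 x = component t0 K 0 x.
Proof. by move=> h; rewrite /influence_set leNgt h /= slab_first. Qed.

Lemma eta_first K s t x : 0 < t -> t <= t0 ->
  eta t0 K s t x = foldl (update K (component t0 K 0 x)) s
    (update_times K (component t0 K 0 x) 0 t) x.
Proof. by move=> h1 h2; rewrite /eta leNgt h1 /= slab_first// /= /evolve mul0r. Qed.

End Components.

Section GammaStar.
Context (R : realType) (S : countType).
Variable (t0 : R) (K : S -> S -> R -> nat).
Hypothesis t0_gt0 : 0 < t0.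
Hypothesis Kmono : forall x y, x != y -> mono (K x y).
Hypothesis Kcadlag : forall x y, x != y -> cadlag (K x y).
Hypothesis K0 : forall x y, x != y -> K x y 0 = 0%N.
Hypothesis Kcomp : forall r, finite_components t0 K r.
Hypothesis Kcells : forall (Q : {fset S * S}) (T : nat),
  (forall p, p \in Q -> p.1 != p.2) ->
  exists m : nat, cells_ok K Q (T.+1%:R / m.+1%:R) m.+1.

Lemma cell_of (h u : R) (m : nat) : 0 < h -> 0 < u -> u <= m%:R * h ->
  exists2 i, (i < m)%N & i%:R * h < u <= i.+1%:R * h.
Proof.
move=> h0 u0; elim: m => [|m IH] um.
  by move: um; rewrite mul0r leNgt u0.
have [/IH[i im iu]|mu] := leP u (m%:R * h).
  by exists i => //; apply: ltn_trans im _.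
by exists m => //; rewrite mu um.
Qed.

Lemma constant_no_jump x y a b u : x != y -> 0 <= a -> a < u <= b ->
  K x y b = K x y a -> K x y u = left_lim (K x y) u.
Proof.
move=> xy a0 /andP[au ub] E; apply/eqP; rewrite eqn_leq; apply/andP; split.
  apply: leq_trans (left_lim_ge (Kcadlag xy) (Kmono xy) a0 au).
  by rewrite -E; apply: Kmono => //; apply: ltW; apply: le_lt_trans au.
by apply: left_lim_le => //; [exact: Kcadlag|exact: Kmono|apply: le_lt_trans au].
Qed.

(** On a sufficiently fine grid a jump of a pair of [Q] is alone in its cell. This
    rules out simultaneous jumps and jumps of size other than one. *)
Lemma jump_single (Q : {fset S * S}) p u : (forall q, q \in Q -> q.1 != q.2) ->
  p \in Q -> jump_times (K p.1 p.2) u ->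
  exists a b, [/\ 0 <= a, a < u <= b & single K Q a b p].
Proof.
move=> Qoff pQ [u0 ju].
have [m ok] := Kcells (Num.truncn u) Qoff.
set h := _ / _ in ok.
have h0 : 0 < h by rewrite divr_gt0.
have um : u <= m.+1%:R * h.
  by rewrite /h mulrC divfK ?pnatr_eq0// ltW// truncnS_gt.
have [i im iu] := cell_of h0 u0 um.
have a0 : 0 <= i%:R * h by rewrite mulr_ge0// ltW.
exists (i%:R * h), (i.+1%:R * h); split => //.
have [q|[q sq]] := ok i im.
  by case: ju; apply: (constant_no_jump (Qoff _ pQ) a0 iu); exact: q.
have [-> //|pq] := eqVneq p q; case: ju.
apply: (constant_no_jump (Qoff _ pQ) a0 iu).
by case: sq => _ _; exact.
Qed.

Lemma sym_path_slab x y r : x != y -> (0 < sym_path K x y (r%:R * t0))%N ->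
  exists2 r', (r' < r)%N & edge t0 K r' x y.
Proof.
move=> xy; elim: r => [|r IH].
  by rewrite mul0r /sym_path !K0// eq_sym.
have [|h] := ltnP 0 (sym_path K x y (r%:R * t0)).
  by move=> /IH[r' r'r e] _; exists r' => //; apply: ltn_trans r'r _.
by move=> h'; exists r => //; rewrite /edge xy; apply: leq_ltn_trans h'.
Qed.

(** A pair that has jumped by time [r * t0] is an edge in one of the first [r] slabs,
    so all but finitely many terms vanish when clusters are finite. *)
Lemma sym_path_summable x t : 0 <= t ->
  ((\esum_(y in [set~ x]) (sym_path K x y t)%:R%:E : \bar R) < +oo)%E.
Proof.
move=> t_ge0; pose r := (Num.truncn (t / t0)).+1.
have tr : t <= r%:R * t0.
  by rewrite -ler_pdivrMr// ltW// truncnS_gt.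
pose B := \bigcup_(r' < r) component t0 K r' x.
have fB : finite_set B.
  by apply: bigcup_finite => [|r' _]; [exact: finite_II|exact: Kcomp].
rewrite (_ : esum _ _ = esum ([set~ x] `&` B) (fun y => (sym_path K x y t)%:R%:E)).
  rewrite esum_fset; last by move=> *; rewrite lee_fin.
    rewrite fsbig_finite /=; last exact: finite_setIr.
    by rewrite sumEFin ltry.
  exact: finite_setIr.
rewrite esum_mkcondr; apply: eq_esum => y /= yx; case: ifPn => // yB.
suff -> : sym_path K x y t = 0%N by [].
apply/eqP; rewrite -leqn0 leqNgt; apply: contra yB => y0; apply/mem_set.
have xy : x != y by apply/eqP => E; apply: yx.
have : (0 < sym_path K x y (r%:R * t0))%N.
  apply: leq_trans y0 _; apply: leq_add; apply: Kmono => //.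
  by rewrite eq_sym.
move=> /(sym_path_slab xy)[r' r'r e]; exists r' => //.
by apply: component_edge e; exact: component_refl.
Qed.

Lemma Gamma_star_intro : Gamma_star t0 K.
Proof.
split => //.
- exact: sym_path_summable.
- move=> x y x' y' xy x'y' ne; rewrite -subset0 => u [ju ju'].
  pose Q : {fset S * S} := [fset (x, y); (x', y')]%fset.
  have Qoff q : q \in Q -> q.1 != q.2 by rewrite !inE => /orP[]/eqP->.
  have xyQ : (x, y) \in Q by rewrite !inE eqxx.
  have xyQ' : (x', y') \in Q by rewrite !inE eqxx orbT.
  have [a [b [a0 aub [_ _ other]]]] := @jump_single Q (x, y) u Qoff xyQ ju.
  have ne' : (x', y') != (x, y) by apply/eqP => E; apply: ne.
  case: ju' => _; apply.
  by apply: (constant_no_jump x'y' a0 aub); exact: (other _ xyQ' ne').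
- move=> x y u xy ju.
  pose Q : {fset S * S} := [fset (x, y)]%fset.
  have Qoff q : q \in Q -> q.1 != q.2 by rewrite !inE => /eqP->.
  have xyQ : (x, y) \in Q by rewrite !inE eqxx.
  have [a [b [a0 aub [_ /= Kb _]]]] := @jump_single Q (x, y) u Qoff xyQ ju.
  case/andP: aub => au ub; case: ju => u0 ju.
  have h1 := left_lim_ge (Kcadlag xy) (Kmono xy) a0 au.
  have h2 := left_lim_le (Kcadlag xy) (Kmono xy) u0.
  have h3 := Kmono xy (ltW u0) ub.
  apply/eqP; rewrite eqn_leq (leq_trans h3) ?Kb ?ltnS//=.
  by rewrite ltn_neqAle h2 andbT; apply/eqP => E; apply: ju.
Qed.

End GammaStar.

(** * Joint law of the increments *)

Section JointLaw.
Context d (Omega : measurableType d) (R : realType) (P : probability Omega R).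
Context (S : countType) (c : S -> S -> R) (N : Omega -> S -> S -> R -> nat).
Hypothesis c_ge0 : forall x y, 0 <= c x y.
Hypothesis N_poisson : poisson_family P c N.
Implicit Types (p : S * S) (Q : {fset S * S}) (a b h : R).

Definition incr_event p a b (k : nat) : set Omega :=
  [set w | increment (fun w => N w p.1 p.2) a b w = k%:R].

Lemma incr_eventE p a b k w :
  incr_event p a b k w <-> N w p.1 p.2 b = (N w p.1 p.2 a + k)%N.
Proof.
rewrite /incr_event /increment /=; split => [/eqP|->].
  by rewrite subr_eq addrC -natrD eqr_nat => /eqP.
by rewrite natrD addrAC subrr add0r.
Qed.

Lemma process_sigma_algebraE p (A : set Omega) :
  process_sigma_algebra (fun w => N w p.1 p.2) A <->
  (measurable : set (set (g_sigma_algebraType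
     [set A | exists t n, 0 <= t /\ A = [set w | N w p.1 p.2 t = n]]))) A.
Proof. by []. Qed.

Lemma incr_event_process p a b k : 0 <= a -> 0 <= b ->
  process_sigma_algebra (fun w => N w p.1 p.2) (incr_event p a b k).
Proof.
move=> a0 b0; apply/process_sigma_algebraE.
rewrite (_ : incr_event _ _ _ _ = \bigcup_n
  ([set w | N w p.1 p.2 a = n] `&` [set w | N w p.1 p.2 b = (n + k)%N])).
  apply: bigcupT_measurable => n.
  by apply: measurableI; apply: sub_sigma_algebra; [exists a, n|exists b, (n + k)%N].
apply/seteqP; split => w.
  by move=> /incr_eventE E; exists (N w p.1 p.2 a).
by move=> [n _ [/= E1 E2]]; apply/incr_eventE; rewrite E2 E1.
Qed.

Lemma process_measurable p (A : set Omega) : p.1 != p.2 ->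
  process_sigma_algebra (fun w => N w p.1 p.2) A -> measurable A.
Proof.
move=> pne; have [_ mX _ _ _] := N_poisson.1 _ _ pne.
apply: smallest_sub; first exact: sigma_algebra_measurable.
move=> _ [t [n [t_ge0 ->]]].
by rewrite -[X in measurable X]setTI; apply: (mX t t_ge0 measurableT [set n]).
Qed.

Lemma incr_event_measurable p a b k : p.1 != p.2 -> 0 <= a -> 0 <= b ->
  measurable (incr_event p a b k).
Proof. by move=> pne a0 b0; apply: (process_measurable pne); exact: incr_event_process. Qed.

Definition pois (l : R) (k : nat) : R := l ^+ k / k`!%:R * expR (- l).

Lemma P_incr_event p a b k : p.1 != p.2 -> 0 <= a -> a < b ->
  P (incr_event p a b k) = (pois (c p.1 p.2 * (b - a)) k)%:E.
Proof.
by move=> pne a0 ab; have [_ _ _ hP _] := N_poisson.1 _ _ pne; exact: hP.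
Qed.

Lemma P_pairs_indep Q (A : S * S -> set Omega) :
  (forall p, p \in Q -> p.1 != p.2) ->
  (forall p, p \in Q -> process_sigma_algebra (fun w => N w p.1 p.2) (A p)) ->
  P (\bigcap_(p in [set` Q]) A p) = (\prod_(p <- Q) P (A p))%E.
Proof. by move=> Qoff hA; apply: N_poisson.2. Qed.

Lemma P_cells_indep p m (J : {fset 'I_m}) h (k : 'I_m -> nat) : p.1 != p.2 -> 0 < h ->
  P (\bigcap_(i in [set` J]) incr_event p (i%:R * h) (i.+1%:R * h) (k i)) =
  (\prod_(i <- J) P (incr_event p (i%:R * h) (i.+1%:R * h) (k i)))%E.
Proof.
move=> pne h0; have [_ _ _ _ hI] := N_poisson.1 _ _ pne.
apply: (hI m (fun i => i%:R * h)) => //; first by rewrite mul0r.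
  by move=> i; rewrite ltr_pM2r// ltr_nat.
move=> i _; exists [set (k i)%:R] => //.
by rewrite setTI.
Qed.

Definition cell_single Q h (i : nat) p : set Omega :=
  \bigcap_(p' in [set` Q]) incr_event p' (i%:R * h) (i.+1%:R * h) (p' == p).

(** The probability that, over a time [h], the pair [p] jumps once and the other pairs
    of [Q] do not jump. *)
Definition cell_rate Q h p : R :=
  c p.1 p.2 * h * expR (- (h * \sum_(p' <- Q) c p'.1 p'.2)).

Lemma prod_pois Q h p : p \in Q ->
  \prod_(p' <- Q) pois (c p'.1 p'.2 * h) (p' == p) = cell_rate Q h p.
Proof.
move=> pQ; rewrite /pois big_split /=; congr (_ * _).
  rewrite (big_rem p pQ) /= eqxx expr1 (_ : (true : nat)`! = 1%N)// invr1 mulr1 big_seq big1 ?mulr1// => q.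
  rewrite rem_filter ?fset_uniq// mem_filter => /andP[/= /negbTE ->].
  by rewrite fact0 invr1 mulr1.
rewrite -expR_sum; congr expR.
by rewrite sumrN mulr_sumr; congr (- _); apply: eq_bigr => q _; rewrite mulrC.
Qed.

(** Regrouping the increments by pairs, independence of the processes separates the
    pairs and independence of the increments separates the cells. *)
Lemma P_cell_singles Q h m (J : {fset 'I_m}) (a : 'I_m -> S * S) :
  (forall p, p \in Q -> p.1 != p.2) -> 0 < h ->
  (forall j, j \in J -> a j \in Q) ->
  P (\bigcap_(j in [set` J]) cell_single Q h j (a j)) =
  (\prod_(j <- J) cell_rate Q h (a j))%:E.
Proof.
move=> Qoff h0 aQ.
pose A p := \bigcap_(j in [set` J]) incr_event p (j%:R * h) (j.+1%:R * h) (p == a j).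
have -> : \bigcap_(j in [set` J]) cell_single Q h j (a j) = \bigcap_(p in [set` Q]) A p.
  by apply/seteqP; split => w hw i iI j jJ; apply: hw.
rewrite P_pairs_indep//; last first.
  move=> p pQ; apply/process_sigma_algebraE; apply: fin_bigcap_measurable => //.
  by move=> j _; apply: incr_event_process; rewrite mulr_ge0// ltW.
transitivity (\prod_(p <- Q) \prod_(j <- J) (pois (c p.1 p.2 * h) (p == a j))%:E)%E.
  rewrite big_seq [RHS]big_seq; apply: eq_bigr => p pQ.
  rewrite P_cells_indep ?Qoff//; apply: eq_bigr => j _; rewrite P_incr_event ?Qoff//.
  - by rewrite -mulrBl -natrB// subSnn mul1r.
  - by rewrite mulr_ge0// ltW.
  - by rewrite ltr_pM2r// ltr_nat.
rewrite exchange_big /= -prodEFin big_seq [RHS]big_seq; apply: eq_bigr => j jJ.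
by rewrite prodEFin prod_pois ?aQ.
Qed.

End JointLaw.

(** * Iterated averages as expectations *)

Section IterAverage.
Context (R : realType) (S : countType).
Variables (Q : {fset S * S}) (q : S * S -> R).
Implicit Types (g : config S -> R).

Lemma iter_averageD i g g' : iter i (average Q q) (fun s => g s + g' s) =
  fun s => iter i (average Q q) g s + iter i (average Q q) g' s.
Proof. by elim: i => //= i ->; rewrite averageD. Qed.

Lemma iter_averageZ i (a : R) g : iter i (average Q q) (fun s => a * g s) =
  fun s => a * iter i (average Q q) g s.
Proof. by elim: i => //= i ->; rewrite averageZ. Qed.

Lemma iter_average0 i : iter i (average Q q) (fun=> 0) = fun=> 0.
Proof. by elim: i => //= i ->; rewrite average0. Qed.

Lemma iter_average_sum (I : Type) (r : seq I) i (G : I -> config S -> R) :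
  iter i (average Q q) (fun s => \sum_(j <- r) G j s) =
  fun s => \sum_(j <- r) iter i (average Q q) (G j) s.
Proof.
elim: r => [|j r IH].
  rewrite (_ : (fun s => _) = fun=> 0) ?iter_average0; last first.
    by apply/funext => s; rewrite big_nil.
  by apply/funext => s; rewrite big_nil.
rewrite (_ : (fun s => _) = fun s => G j s + \sum_(j <- r) G j s); last first.
  by apply/funext => s; rewrite big_cons.
by rewrite iter_averageD IH; apply/funext => s; rewrite big_cons.
Qed.

Lemma iter_average_average i g s : iter i (average Q q) (average Q q g) s =
  iter i (average Q q) g s +
  \sum_(p <- Q) q p * iter i (average Q q) (fun s => g (hop p s) - g s) s.
Proof.
rewrite /average iter_averageD iter_average_sum; congr (_ + _).
by apply: eq_bigr => p _; rewrite iter_averageZ.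
Qed.

End IterAverage.

Section BoundedIntegrals.
Context d (T : measurableType d) (R : realType) (mu : probability T R).

Lemma integrable_bigsum (I : Type) (r : seq I) (F : I -> T -> R) (D : set T) :
  measurable D -> (forall i, mu.-integrable D (EFin \o F i)) ->
  mu.-integrable D (EFin \o (fun x => \sum_(i <- r) F i x)).
Proof.
move=> mD iF; rewrite (_ : _ \o _ = fun x => (\sum_(i <- r) (F i x)%:E)%E).
  by apply: integrable_sum => // i _; exact: iF.
by apply/funext => x /=; rewrite sumEFin.
Qed.

Lemma Rintegral_sum (I : Type) (r : seq I) (F : I -> T -> R) (D : set T) :
  measurable D -> (forall i, mu.-integrable D (EFin \o F i)) ->
  \int[mu]_(x in D) (\sum_(i <- r) F i x) = \sum_(i <- r) \int[mu]_(x in D) F i x.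
Proof.
move=> mD iF; elim: r => [|i r IH].
  rewrite big_nil; under eq_Rintegral do rewrite big_nil.
  by rewrite Rintegral_cst// mul0r.
rewrite big_cons -IH; under eq_Rintegral do rewrite big_cons.
by rewrite RintegralD//; exact: integrable_bigsum.
Qed.

Lemma integrable_indicator (A D : set T) : measurable D -> measurable A ->
  mu.-integrable D (EFin \o (\1_A : T -> R)).
Proof.
move=> mD mA; apply: (@bounded_integrable _ _ _ _ _ _ 1) => //.
by move=> x _; rewrite indicE; case: (_ \in _); rewrite ?normr1 ?normr0.
Qed.

Lemma Rintegral_indicator (A : set T) : measurable A ->
  \int[mu]_x \1_A x = fine (mu A).
Proof. by move=> mA; rewrite /Rintegral integral_indic// setIT. Qed.

End BoundedIntegrals.

Section ChainExpectation.
Context d (Omega : measurableType d) (R : realType) (P : probability Omega R).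
Context (S : countType) (c : S -> S -> R) (N : Omega -> S -> S -> R -> nat).
Hypothesis c_ge0 : forall x y, 0 <= c x y.
Hypothesis N_poisson : poisson_family P c N.
Variables (Q : {fset S * S}) (h : R) (x0 : S).
Hypothesis Qoff : forall p, p \in Q -> p.1 != p.2.
Hypothesis h_gt0 : 0 < h.
Implicit Types (s : config S) (g : config S -> R).

Local Notation q := (cell_rate c Q h).
Local Notation cell := (cell_single N Q h).

Lemma cell_singleE i p w : p \in Q ->
  cell i p w <-> single (N w) Q (i%:R * h) (i.+1%:R * h) p.
Proof.
move=> pQ; split=> [hw|[_ Kp Kother] p' /= p'Q]; last first.
  apply/incr_eventE; have [->|ne] := eqVneq p' p; first by rewrite Kp addn1.
  by rewrite addn0; apply: Kother.
split => //; first by have /incr_eventE := hw p pQ; rewrite eqxx addn1.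
by move=> p' p'Q /negbTE ne; have /incr_eventE := hw p' p'Q; rewrite ne addn0.
Qed.

Lemma cell_measurable i p : measurable (cell i p).
Proof.
apply: fin_bigcap_measurable => // p' p'Q; apply: incr_event_measurable N_poisson _ _ _ _ _ _ _.
- exact: Qoff.
- by rewrite mulr_ge0// ltW.
- by rewrite mulr_ge0// ltW.
Qed.

(** At most one of the indicators is nonzero, and when all vanish the cell acts as the
    identity. *)
Lemma chain_step g i s w : g (chain (N w) Q h i.+1 s) =
  g (chain (N w) Q h i s) + \sum_(p <- Q) \1_(cell i p) w *
    (g (hop p (chain (N w) Q h i s)) - g (chain (N w) Q h i s)).
Proof.
set z := chain _ _ _ i s; rewrite [chain _ _ _ _ _]/= -/z.
have [[p sp]|none] := pselect (exists p, single (N w) Q (i%:R * h) (i.+1%:R * h) p).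
  have pQ : p \in Q by case: sp.
  rewrite (cell_map_single _ sp) (big_rem p pQ) /= [X in _ + (_ + X)]big1_seq.
    rewrite indicE mem_set ?mul1r ?addr0; last exact/cell_singleE.
    by rewrite addrC subrK.
  move=> p' /andP[_]; rewrite rem_filter ?fset_uniq// mem_filter => /andP[/= ne p'Q].
  rewrite indicE memNset ?mul0r// => /(cell_singleE _ _ p'Q) /(single_inj sp) E.
  by rewrite E eqxx in ne.
rewrite cell_map_none// big1_seq ?addr0// => p /andP[_ pQ].
by rewrite indicE memNset ?mul0r// => /(cell_singleE _ _ pQ) sp; apply: none; exists p.
Qed.

Lemma chain_measurable g i s :
  measurable_fun setT (fun w => g (chain (N w) Q h i s)).
Proof.
elim: i g => [|i IH] g; first by rewrite /=; exact: measurable_cst.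
under eq_fun do rewrite chain_step.
apply: measurable_funD => //; apply: measurable_sum => p.
apply: measurable_funM; first exact/measurable_indic/cell_measurable.
by apply: measurable_funB => //; exact: (IH (fun s => g (hop p s))).
Qed.

(** To peel off the last cell one needs its independence of the earlier ones; carrying
    an arbitrary event about later cells through the induction provides it. *)
Lemma chain_expectation_cells (m : nat) (g : config S -> R) (M : R) s i
    (J : {fset 'I_m}) (a : 'I_m -> S * S) : (forall s, `|g s| <= M) ->
  (i <= m)%N -> (forall j, j \in J -> (i <= j)%N /\ a j \in Q) ->
  \int[P]_w (g (chain (N w) Q h i s) * \1_(\bigcap_(j in [set` J]) cell j (a j)) w) =
  iter i (average Q q) g s * \prod_(j <- J) q (a j).
Proof.
elim: i g M J a => [|i IH] g M J a gM im Ji.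
  have mE : measurable (\bigcap_(j in [set` J]) cell j (a j)).
    by apply: fin_bigcap_measurable => // j _; exact: cell_measurable.
  rewrite /= RintegralZl//; last exact: integrable_indicator.
  rewrite Rintegral_indicator// (P_cell_singles N_poisson)//=.
  by move=> j /Ji[].
(* [J'] and [a' p] add to the event the requirement that [p] jumps alone in cell [i]. *)
pose o := Ordinal im.
pose J' := (o |` J)%fset.
pose a' p j := if j == o then p else a j.
pose E := \bigcap_(j in [set` J]) cell j (a j).
have oJ : o \notin J by apply/negP => /Ji[]; rewrite ltnn.
have J'E p : \bigcap_(j in [set` J']) cell j (a' p j) = cell i p `&` E.
  apply/seteqP; split=> [w hw|w [hp hw] j /=].
    split=> [|j jJ].
      by have := hw o; rewrite /= !inE eqxx /a' eqxx; apply.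
    have := hw j; rewrite /= !inE (_ : j \in J)// orbT /a'.
    by case: eqP => [jo|_]; [rewrite jo in jJ; case/negP: oJ|apply].
  rewrite !inE => /orP[/eqP->|jJ]; first by rewrite /a' eqxx.
  rewrite /a'; case: eqP => [jo|_]; last exact: hw.
  by rewrite jo in jJ; case/negP: oJ.
have mE : measurable E.
  by apply: fin_bigcap_measurable => // j _; exact: cell_measurable.
have J'Q p : p \in Q -> forall j, j \in J' -> (i <= j)%N /\ a' p j \in Q.
  move=> pQ j; rewrite !inE => /orP[/eqP->|jJ]; first by rewrite /a' eqxx.
  have [ij aj] := Ji j jJ; split; first exact: ltnW.
  by rewrite /a'; case: eqP.
have int_chain (f : config S -> R) (A : set Omega) (F : R) : measurable A ->
    (forall s, `|f s| <= F) ->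
    P.-integrable setT (EFin \o (fun w => f (chain (N w) Q h i s) * \1_A w)).
  move=> mA fF; apply: (@bounded_integrable _ _ _ _ _ _ F) => //.
    by apply: measurable_funM; [exact: chain_measurable|exact: measurable_indic].
  move=> w _; rewrite normrM indicE; case: (_ \in _); rewrite ?normr1 ?mulr1//.
  by rewrite normr0 mulr0; apply: le_trans (fF point).
pose G p s := g (hop p s) - g s.
have GM p s' : `|G p s'| <= M + M by apply: le_trans (ler_normB _ _) _; apply: lerD.
transitivity (\int[P]_w (g (chain (N w) Q h i s) * \1_E w +
    \sum_(p <- Q) G p (chain (N w) Q h i s) * \1_(cell i p `&` E) w)).
  apply: eq_Rintegral => w _; rewrite chain_step mulrDl; congr (_ + _).
  by rewrite mulr_suml; apply: eq_bigr => p _; rewrite indicI /= /G; ring.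
rewrite RintegralD//; last 2 first.
- exact: (int_chain _ _ M).
- apply: integrable_bigsum => // p; apply: (int_chain (G p) _ (M + M)) => //.
  by apply: measurableI => //; exact: cell_measurable.
rewrite Rintegral_sum//; last first.
  move=> p; apply: (int_chain (G p) _ (M + M)) => //.
  by apply: measurableI => //; exact: cell_measurable.
rewrite (IH g M J a gM (ltnW im)); last by move=> j /Ji[/ltnW].
rewrite iterSr iter_average_average mulrDl mulr_suml; congr (_ + _).
rewrite big_seq [RHS]big_seq; apply: eq_bigr => p pQ.
rewrite -J'E (IH (G p) (M + M) J' (a' p) (GM p) (ltnW im) (J'Q _ pQ)).
rewrite big_fsetU1//= {1}/a' eqxx.
have -> : \prod_(j <- J) q (a' p j) = \prod_(j <- J) q (a j).
  rewrite big_seq [RHS]big_seq; apply: eq_bigr => j jJ.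
  by rewrite /a'; case: eqP => // jo; rewrite jo in jJ; case/negP: oJ.
by rewrite /G mulrCA mulrA.
Qed.

Lemma chain_expectation (g : config S -> R) (M : R) s i : (forall s, `|g s| <= M) ->
  \int[P]_w g (chain (N w) Q h i s) = iter i (average Q q) g s.
Proof.
move=> gM.
have := @chain_expectation_cells i g M s i fset0 (fun=> (x0, x0)) gM (leqnn _).
rewrite big_seq_fset0 mulr1 => <- //; apply: eq_Rintegral => w _.
by rewrite indicE mem_set ?mulr1// => j.
Qed.

End ChainExpectation.

(** * Grids whose cells contain at most one jump *)

Section CountableMeasurability.
Context d (T : measurableType d) (I : countType).

Lemma measurable_exists (F : I -> set T) : (forall i, measurable (F i)) ->
  measurable [set w | exists i, F i w].
Proof.
move=> mF; rewrite (_ : mkset _ = \bigcup_i F i).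
  by apply: countable_bigcupT_measurable => //; exact: countableP.
by apply/seteqP; split => w [i]; [exists i|move=> _ Fi; exists i].
Qed.

Lemma measurable_forall (F : I -> set T) : (forall i, measurable (F i)) ->
  measurable [set w | forall i, F i w].
Proof.
move=> mF; rewrite -[X in measurable X]setCK; apply: measurableC.
rewrite (_ : ~` _ = [set w | exists i, (~` F i) w]).
  by apply: measurable_exists => i; exact: measurableC.
by apply/seteqP; split => w /=; [move/existsNP|move=> h; apply/existsNP].
Qed.

Lemma measurable_implies (A : set T) (Q : Prop) : measurable A ->
  measurable [set w | Q -> A w].
Proof.
move=> mA; have [q|nq] := pselect Q.
  by rewrite (_ : mkset _ = A)//; apply/seteqP; split => w /=; auto.
by rewrite (_ : mkset _ = setT)//; apply/seteqP; split => w //= _ /nq.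
Qed.

Lemma measurable_and (A : set T) (Q : Prop) : measurable A ->
  measurable [set w | Q /\ A w].
Proof.
move=> mA; have [q|nq] := pselect Q.
  by rewrite (_ : mkset _ = A)//; apply/seteqP; split => w /=; [case|].
by rewrite (_ : mkset _ = set0)// -subset0 => w [/nq].
Qed.

End CountableMeasurability.

Section NullSets.
Context d (T : measurableType d) (R : realType) (mu : probability T R).

Lemma probability_null (A : set T) (a : R) : measurable A ->
  (forall n : nat, (mu A <= (a / n.+1%:R)%:E)%E) -> mu A = 0%E.
Proof.
move=> mA h; have fA : mu A \is a fin_num by rewrite fin_num_measure.
apply/eqP; rewrite eq_le measure_ge0 andbT -(fineK fA) lee_fin.
apply/ler_addgt0Pr => e e0; rewrite add0r.
have [a0|a0] := leP a 0.
  have := h 0%N; rewrite divr1 -(fineK fA) lee_fin => /le_trans; apply.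
  by apply: le_trans a0 (ltW e0).
have := h (Num.truncn (a / e)); rewrite -{1}(fineK fA) lee_fin => /le_trans; apply.
rewrite ler_pdivrMr// -ler_pdivrMl// mulrC; exact/ltW/truncnS_gt.
Qed.

End NullSets.

Section CellsOk.
Context d (Omega : measurableType d) (R : realType) (P : probability Omega R).
Context (S : countType) (c : S -> S -> R) (N : Omega -> S -> S -> R -> nat).
Hypothesis c_ge0 : forall x y, 0 <= c x y.
Hypothesis N_poisson : poisson_family P c N.
Variables (Q : {fset S * S}).
Hypothesis Qoff : forall p, p \in Q -> p.1 != p.2.

Definition total (c : S -> S -> R) (Q : {fset S * S}) : R :=
  \sum_(p <- Q) c p.1 p.2.

Lemma total_ge0 : 0 <= total c Q.
Proof. exact: sumr_ge0. Qed.

Lemma cell_rate_ge0 h p : 0 <= h -> 0 <= cell_rate c Q h p.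
Proof. by move=> h0; rewrite !mulr_ge0// expR_ge0. Qed.

Lemma sum_cell_rate h : \sum_(p <- Q) cell_rate c Q h p =
  h * total c Q * expR (- (h * total c Q)).
Proof.
rewrite /cell_rate -mulr_suml; congr (_ * _).
by rewrite /total mulr_sumr; apply: eq_bigr => p _; rewrite mulrC.
Qed.

Lemma sum_cell_rate_le1 h : 0 <= h -> \sum_(p <- Q) cell_rate c Q h p <= 1.
Proof.
move=> h0; rewrite sum_cell_rate expRN ler_pdivrMr ?expR_gt0// mul1r.
have := expR_ge1Dx (h * total c Q); apply: le_trans; by rewrite lerDr.
Qed.

(** The identity is exact, with no remainder, because the anomalous cells act as the
    identity. *)
Lemma average_cell_rate h g : average Q (cell_rate c Q h) g =
  fun s => g s + h * expR (- (h * total c Q)) * gen_on Q c g s.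
Proof.
apply/funext => s; rewrite /average /gen_on; congr (_ + _).
by rewrite mulr_sumr; apply: eq_bigr => p _; rewrite /cell_rate -/(total c Q); ring.
Qed.

Section Cells.
Variable h : R.
Hypothesis h_gt0 : 0 < h.

Definition cell_ok (i : nat) : set Omega :=
  [set w | quiet (N w) Q (i%:R * h) (i.+1%:R * h) \/
           exists p, single (N w) Q (i%:R * h) (i.+1%:R * h) p].

Definition cell_quiet (i : nat) : set Omega :=
  \bigcap_(p in [set` Q]) incr_event N p (i%:R * h) (i.+1%:R * h) 0.

Lemma cell_quietE i w : cell_quiet i w <-> quiet (N w) Q (i%:R * h) (i.+1%:R * h).
Proof.
split=> hw p pQ.
  by have /incr_eventE := hw p pQ; rewrite addn0.
by apply/incr_eventE; rewrite addn0; exact: hw.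
Qed.

Lemma cell_quiet_measurable i : measurable (cell_quiet i).
Proof.
apply: fin_bigcap_measurable => // p pQ; apply: incr_event_measurable N_poisson _ _ _ _ _ _ _.
- exact: Qoff.
- by rewrite mulr_ge0// ltW.
- by rewrite mulr_ge0// ltW.
Qed.

Lemma cell_okE i : cell_ok i = cell_quiet i `|` \bigcup_(p in [set` Q]) cell_single N Q h i p.
Proof.
apply/seteqP; split=> w [].
- by move=> ?; left; apply/cell_quietE.
- by move=> [p sp]; right; exists p; [case: sp|apply/cell_singleE => //; case: sp].
- by move=> /cell_quietE; left.
- by move=> [p pQ] /(cell_singleE _ _ _ _ pQ) sp; right; exists p.
Qed.

Lemma cell_ok_measurable i : measurable (cell_ok i).
Proof.
rewrite cell_okE; apply: measurableU; first exact: cell_quiet_measurable.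
by apply: fin_bigcup_measurable => // p _; exact: (cell_measurable N_poisson).
Qed.

Lemma P_cell_quiet i : P (cell_quiet i) = (expR (- (h * total c Q)))%:E.
Proof.
rewrite (P_pairs_indep N_poisson)//; last first.
  by move=> p pQ; apply: incr_event_process; rewrite mulr_ge0// ltW.
rewrite -[h * _]/(h * \sum_(p <- Q) c p.1 p.2) mulr_sumr -sumrN expR_sum -prodEFin.
rewrite big_seq [RHS]big_seq; apply: eq_bigr => p pQ.
rewrite (P_incr_event N_poisson _ (Qoff pQ)).
- by rewrite -mulrBl -natrB// subSnn mul1r /pois expr0 fact0 invr1 !mul1r mulrC.
- by rewrite mulr_ge0// ltW.
- by rewrite ltr_pM2r// ltr_nat.
Qed.

Lemma P_cell_single i p : p \in Q ->
  P (cell_single N Q h i p) = (cell_rate c Q h p)%:E.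
Proof.
move=> pQ; have := @P_cell_singles _ _ _ P _ c N N_poisson Q h i.+1 [fset ord_max]%fset
  (fun=> p) Qoff h_gt0 (fun _ _ => pQ).
rewrite big_seq_fset1 => <-; congr (P _).
apply/seteqP; split=> [w hw j /=|w hw]; first by rewrite !inE => /eqP ->.
by apply: (hw ord_max); rewrite /= !inE.
Qed.

(** With [x := h * total c Q], a cell is fine with probability [exp (- x) * (1 + x)],
    which is at least [1 - x ^+ 2]. *)
Lemma P_cell_bad i : (P (~` cell_ok i) <= ((h * total c Q) ^+ 2)%:E)%E.
Proof.
have mok := cell_ok_measurable i.
rewrite probability_setC//.
have fok : P (cell_ok i) \is a fin_num by rewrite fin_num_measure.
have int_ind (A : set Omega) : measurable A -> P.-integrable setT (EFin \o (\1_A : _ -> R)).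
  exact: integrable_indicator.
have mcell p := @cell_measurable _ _ _ P _ c N N_poisson Q h Qoff h_gt0 i p.
have E : fine (P (cell_ok i)) = expR (- (h * total c Q)) +
    \sum_(p <- Q) cell_rate c Q h p.
  rewrite -Rintegral_indicator//.
  transitivity (\int[P]_w (\1_(cell_quiet i) w +
      \sum_(p <- Q) \1_(cell_single N Q h i p) w)).
    apply: eq_Rintegral => w _; rewrite !indicE.
    have quiet_single p : cell_quiet i w -> single (N w) Q (i%:R * h) (i.+1%:R * h) p -> False.
      move=> /cell_quietE q [pQ + _]; rewrite q// => /eqP; by rewrite ltn_eqF.
    have [q|nq] := pselect (cell_quiet i w).
      rewrite mem_set; last by rewrite cell_okE; left.
      rewrite mem_set// big1_seq ?addr0// => p /andP[_ pQ].
      by rewrite indicE memNset// => /(cell_singleE _ _ _ _ pQ); exact: quiet_single.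
    rewrite (memNset nq) add0r.
    have [[p sp]|ns] := pselect (exists p, single (N w) Q (i%:R * h) (i.+1%:R * h) p).
      have pQ : p \in Q by case: sp.
      rewrite mem_set; last by right; exists p.
      rewrite (big_rem p pQ) /= indicE mem_set; last exact/cell_singleE.
      rewrite big1_seq ?addr0// => p' /andP[_].
      rewrite rem_filter ?fset_uniq// mem_filter => /andP[/= ne p'Q].
      rewrite indicE memNset// => /(cell_singleE _ _ _ _ p'Q) /(single_inj sp) E.
      by rewrite E eqxx in ne.
    rewrite memNset; last by rewrite cell_okE => -[//|[p pQ] /(cell_singleE _ _ _ _ pQ) ?]; apply: ns; exists p.
    rewrite big1_seq// => p /andP[_ pQ].
    by rewrite indicE memNset// => /(cell_singleE _ _ _ _ pQ) ?; apply: ns; exists p.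
  rewrite RintegralD//.
  - rewrite Rintegral_sum//; last by move=> p; apply: int_ind; exact: mcell.
    rewrite Rintegral_indicator; last exact: cell_quiet_measurable.
    rewrite P_cell_quiet /=; congr (_ + _); rewrite big_seq [RHS]big_seq.
    by apply: eq_bigr => p pQ; rewrite Rintegral_indicator ?P_cell_single//; exact: mcell.
  - by apply: int_ind; exact: cell_quiet_measurable.
  - by apply: integrable_bigsum => // p; apply: int_ind; exact: mcell.
rewrite -(fineK fok) E -EFinB lee_fin sum_cell_rate.
set x := h * total c Q.
have x0 : 0 <= x by rewrite mulr_ge0 ?total_ge0 ?(ltW h_gt0).
have := expR_ge1Dx (- x) => ex.
have : (1 - x) * (1 + x) <= expR (- x) * (1 + x) by rewrite ler_wpM2r// addr_ge0.
lra.
Qed.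

Definition cells_event (m : nat) : set Omega := [set w | cells_ok (N w) Q h m].

Lemma cells_event_measurable m : measurable (cells_event m).
Proof.
rewrite (_ : cells_event m = [set w | forall i, (i < m)%N -> cell_ok i w])//.
by apply: measurable_forall => i; apply: measurable_implies; exact: cell_ok_measurable.
Qed.

Lemma P_cells_bad m : (P (~` cells_event m) <= (m%:R * (h * total c Q) ^+ 2)%:E)%E.
Proof.
elim: m => [|m IH].
  rewrite (_ : cells_event 0 = setT) ?setCT ?measure0 ?mul0r//.
  by apply/seteqP; split.
have mbad i := measurableC (cell_ok_measurable i).
have mcb i := measurableC (cells_event_measurable i).
apply: (@le_trans _ _ (P (~` cells_event m `|` ~` cell_ok m))).
  apply: le_measure; rewrite ?inE//; first exact: measurableU.
  move=> w nok; apply: contrapT => /not_orP[/contrapT hm /contrapT ho]; apply: nok => i.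
  by rewrite ltnS leq_eqVlt => /orP[/eqP->//|]; exact: hm.
apply: le_trans (measureU2 _ _ _) _ => //.
apply: le_trans (leeD IH (P_cell_bad m)) _.
by rewrite -EFinD lee_fin -natr1 mulrDl mul1r.
Qed.

End Cells.

Lemma P_grid_bad (T : R) (m : nat) : 0 < T ->
  (P (~` cells_event (T / m.+1%:R) m.+1) <= ((T * total c Q) ^+ 2 / m.+1%:R)%:E)%E.
Proof.
move=> T0; apply: le_trans (P_cells_bad _ _) _; first by rewrite divr_gt0.
rewrite lee_fin !expr2; set C := total c Q; set n := m.+1%:R.
have n0 : n != 0 by rewrite pnatr_eq0.
by rewrite le_eqVlt; apply/orP; left; apply/eqP; field.
Qed.

(** The bound of [P_grid_bad] tends to [0] as the grids are refined, so the event that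
    all grids from some index on are bad is null. *)
Lemma ae_cells_ok (T : R) : 0 < T ->
  {ae P, forall w, forall n : nat, exists2 m, (n <= m)%N &
    cells_ok (N w) Q (T / m.+1%:R) m.+1}.
Proof.
move=> T0; apply: ae_forall_countable => n.
pose B := [set w | forall m, (n <= m)%N -> ~ cells_event (T / m.+1%:R) m.+1 w].
have mB : measurable B.
  apply: measurable_forall => m; apply: measurable_implies; apply: measurableC.
  by apply: cells_event_measurable; rewrite divr_gt0.
exists B; split => //; last first.
  by move=> w /= nw m nm ok; apply: nw; exists m.
apply: (@probability_null _ _ _ _ _ ((T * total c Q) ^+ 2)) => // k.
pose m := maxn n k.
apply: (@le_trans _ _ (P (~` cells_event (T / m.+1%:R) m.+1))).
  apply: le_measure; rewrite ?inE//.
    by apply/measurableC/cells_event_measurable; rewrite divr_gt0.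
  by move=> w; apply; exact: leq_maxl.
apply: le_trans (P_grid_bad _ T0) _.
rewrite lee_fin ler_wpM2l ?sqr_ge0// lef_pV2 ?posrE// ler_nat ltnS.
exact: leq_maxr.
Qed.

End CellsOk.

(** * The graphical event has probability one *)

(** Good grids of arbitrarily small mesh give monotonicity on dense sets of times, and
    right-continuity extends it to all times. *)
Lemma mono_of_cells (R : realType) (S : countType) (K : S -> S -> R -> nat) p :
  cadlag (K p.1 p.2) ->
  (forall T n : nat, exists2 m, (n <= m)%N &
     cells_ok K [fset p]%fset (T.+1%:R / m.+1%:R) m.+1) ->
  mono (K p.1 p.2).
Proof.
move=> cK cells s t s0; rewrite le_eqVlt => /orP[/eqP->//|st].
have t0 := le_lt_trans s0 st.
pose T := Num.truncn t.
have tT : t < T.+1%:R by exact: truncnS_gt.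
have [e1 e1_gt0 K1] := right_constant cK s0.
have [e2 e2_gt0 K2] := right_constant cK (ltW t0).
pose e := Num.min e1 e2.
have e_gt0 : 0 < e by rewrite lt_min e1_gt0.
have [m nm ok] := cells T (Num.truncn (T.+1%:R / e)).
set h := _ / _ in ok.
have h_gt0 : 0 < h by rewrite divr_gt0.
have he : h < e.
  rewrite /h ltr_pdivrMr// mulrC -ltr_pdivrMr//.
  by apply: lt_le_trans (truncnS_gt _) _; rewrite ler_nat.
have steps i : (i < m.+1)%N -> (K p.1 p.2 (i%:R * h)%R <= K p.1 p.2 (i.+1%:R * h)%R)%N.
  move=> /ok[q|[p' [p'Q Kp _]]]; first by rewrite (q p) ?inE.
  by move: p'Q; rewrite inE => /eqP E; rewrite E in Kp; rewrite Kp.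
have grid i j : (i <= j)%N -> (j <= m.+1)%N ->
    (K p.1 p.2 (i%:R * h)%R <= K p.1 p.2 (j%:R * h)%R)%N.
  elim: j => [|j IH]; first by rewrite leqn0 => /eqP->.
  rewrite leq_eqVlt => /orP[/eqP->//|]; rewrite ltnS => ij jm.
  by apply: leq_trans (IH ij (ltnW jm)) _; exact: steps.
(* [(i u)%:R * h] is the first grid point after [u]. *)
pose i u := (Num.truncn (u / h)).+1.
have above u : u < (i u)%:R * h by rewrite -ltr_pdivrMr//; exact: truncnS_gt.
have below u : 0 <= u -> (i u)%:R * h <= u + h.
  move=> u0; rewrite /i -natr1 mulrDl mul1r lerD2r -ler_pdivlMr//.
  by rewrite truncn_le divr_ge0// ltW.
rewrite -(K1 ((i s)%:R * h)); last first.
- by apply: le_lt_trans (below _ s0) _; rewrite ltrD2l (lt_le_trans he)// ge_min lexx.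
- exact/ltW/above.
rewrite -(K2 ((i t)%:R * h)); last first.
- by apply: le_lt_trans (below _ (ltW t0)) _; rewrite ltrD2l (lt_le_trans he)// ge_min lexx orbT.
- exact/ltW/above.
apply: grid.
  rewrite /i ltnS; apply: le_truncn; first by rewrite ler_pM2r ?invr_gt0// ltW.
rewrite /i -(ltr_nat R); apply: le_lt_trans (_ : t / h < _).
  by rewrite truncn_le divr_ge0// ltW.
by rewrite ltr_pdivrMr// /h mulrC divfK// pnatr_eq0.
Qed.

Section Stationarity.
Context d (Omega : measurableType d) (R : realType) (P : probability Omega R).
Context (S : countType) (c : S -> S -> R) (N : Omega -> S -> S -> R -> nat).
Hypothesis c_ge0 : forall x y, 0 <= c x y.
Hypothesis N_poisson : poisson_family P c N.
Variable t0 : R.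
Hypothesis t0_gt0 : 0 < t0.

Definition still (r : nat) (w : Omega) : S * S -> Prop :=
  fun p => incr_event N p (r%:R * t0) (r.+1%:R * t0) 0 w.

Definition cylinders : set (set (S * S -> Prop)) :=
  [set E | exists2 Q : {fset S * S}, (forall p, p \in Q -> p.1 != p.2) &
    E = [set b | forall p, p \in Q -> b p]].

Definition same_law (r : nat) : set (set (S * S -> Prop)) :=
  [set E | [/\ measurable (still r @^-1` E), measurable (still 0 @^-1` E) &
    P (still r @^-1` E) = P (still 0 @^-1` E)]].

Lemma cylinders_same_law r : cylinders `<=` same_law r.
Proof.
have slab0 s : 0 <= s%:R * t0 by rewrite mulr_ge0// ltW.
have E s (Q : {fset S * S}) : still s @^-1` [set b | forall p, p \in Q -> b p] =
    \bigcap_(p in [set` Q]) incr_event N p (s%:R * t0) (s.+1%:R * t0) 0 by [].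
have law s (Q : {fset S * S}) : (forall p, p \in Q -> p.1 != p.2) ->
    P (\bigcap_(p in [set` Q]) incr_event N p (s%:R * t0) (s.+1%:R * t0) 0) =
    (\prod_(p <- Q) (pois (c p.1 p.2 * t0) 0)%:E)%E.
  move=> Qoff; rewrite (P_pairs_indep N_poisson)//; last first.
    by move=> p _; apply: incr_event_process.
  rewrite big_seq [RHS]big_seq; apply: eq_bigr => p pQ.
  rewrite (P_incr_event N_poisson _ (Qoff _ pQ))//; last by rewrite ltr_pM2r// ltr_nat.
  by rewrite -mulrBl -natrB// subSnn mul1r.
have mE s (Q : {fset S * S}) : (forall p, p \in Q -> p.1 != p.2) ->
    measurable (\bigcap_(p in [set` Q]) incr_event N p (s%:R * t0) (s.+1%:R * t0) 0).
  move=> Qoff; apply: fin_bigcap_measurable => // p pQ.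
  by apply: (incr_event_measurable N_poisson) => //; exact: Qoff.
move=> _ [Q Qoff ->]; split; rewrite ?E ?law//; exact: mE.
Qed.

Lemma cylinders_setI : setI_closed cylinders.
Proof.
move=> _ _ [Q1 off1 ->] [Q2 off2 ->]; exists (Q1 `|` Q2)%fset.
  by move=> p; rewrite inE => /orP[/off1|/off2].
apply/seteqP; split=> b.
  by move=> [h1 h2] p; rewrite inE => /orP[/h1|/h2].
by move=> h; split=> p pQ; apply: h; rewrite inE pQ ?orbT.
Qed.

Lemma same_law_lambda r : lambda_system setT (same_law r).
Proof.
split => //.
- by split; rewrite ?preimage_setT//; exact: measurableT.
- move=> A B BA [mA0 mA1 eA] [mB0 mB1 eB].
  split; rewrite ?preimage_setD; [exact: measurableD|exact: measurableD|].
  rewrite !measureD//= ?eA.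
  + by rewrite !setIidr ?eB//; apply: preimage_subset.
  + by rewrite (le_lt_trans (probability_le1 _ _))// ltry.
  + by rewrite (le_lt_trans (probability_le1 _ _))// ltry.
- move=> F ndF FH; split; rewrite ?preimage_bigcup.
  + by apply: bigcupT_measurable => i; case: (FH i).
  + by apply: bigcupT_measurable => i; case: (FH i).
  have cv s : (forall i, measurable (still s @^-1` F i)) ->
      P (still s @^-1` F i) @[i --> \oo] --> P (\bigcup_i (still s @^-1` F i)).
    move=> mF; apply: nondecreasing_cvg_mu => //; first exact: bigcupT_measurable.
    by move=> i j ij; apply/subsetPset; apply: preimage_subset; apply/subsetPset; exact: ndF.
  have c1 := cv r (fun i => let: And3 m _ _ := FH i in m).
  have c2 := cv 0%N (fun i => let: And3 _ m _ := FH i in m).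
  have E : (fun i => P (still r @^-1` F i)) = (fun i => P (still 0 @^-1` F i)).
    by apply/funext => i; case: (FH i).
  by rewrite E in c1; apply: cvg_unique c1 c2.
Qed.

(** Dynkin's argument: the laws of [still r] and [still 0] agree on the pi-system of
    cylinders, by independence of the processes and stationarity of increments. *)
Lemma sigma_same_law r : <<s cylinders >> `<=` same_law r.
Proof.
apply: lambda_system_subset => //; first exact: cylinders_setI.
- exact: same_law_lambda.
- exact: cylinders_same_law.
Qed.

(** Finiteness of clusters as a property of the still pairs alone, so that it can be
    compared between slabs; see [finite_components_closed]. *)
Definition still_components : set (S * S -> Prop) :=
  [set b | forall x, exists B : {fset S}, x \in B /\
    forall y, y \in B -> forall z, z \notin B -> b (y, z) /\ b (z, y)].

Lemma still_components_sigma : <<s cylinders >> still_components.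
Proof.
pose T' := g_sigma_algebraType cylinders.
have mb p : p.1 != p.2 -> (measurable : set (set T')) [set b : T' | b p].
  move=> pne; apply: sub_sigma_algebra; exists [fset p]%fset.
    by move=> q; rewrite inE => /eqP->.
  apply/seteqP; split=> b /=; first by move=> bp q; rewrite inE => /eqP->.
  by apply; rewrite inE.
suff : (measurable : set (set T')) still_components by [].
apply: measurable_forall => x; apply: measurable_exists => B; apply: measurable_and.
apply: measurable_forall => y; have [yB|/negP yB] := boolP (y \in B); last first.
  by rewrite [X in measurable X](_ : _ = setT)//; apply/seteqP; split => // b _ /yB.
apply: measurable_implies.
apply: measurable_forall => z; have [zB|zB] := boolP (z \in B).
  by rewrite [X in measurable X](_ : _ = setT)//; apply/seteqP; split.
apply: measurable_implies.
have yz : y != z by apply: contraNneq zB => <-.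
by apply: measurableI; apply: mb; rewrite //= eq_sym.
Qed.

Lemma ae_mono : {ae P, forall w, forall x y, x != y -> mono (N w x y)}.
Proof.
have H (pT : (S * S) * nat) : {ae P, forall w, pT.1.1 != pT.1.2 -> forall n : nat,
    exists2 m, (n <= m)%N &
    cells_ok (N w) [fset pT.1]%fset (pT.2.+1%:R / m.+1%:R) m.+1}.
  have [pne|_] := boolP (pT.1.1 != pT.1.2); last by apply: aeW => w.
  have Qoff p : p \in [fset pT.1]%fset -> p.1 != p.2 by rewrite inE => /eqP->.
  have := ae_cells_ok c_ge0 N_poisson Qoff (ltr0Sn R pT.2).
  by apply: filterS => w.
have := ae_forall_countable H; apply: filterS => w hw x y xy.
apply: (@mono_of_cells _ _ _ (x, y)).
  by have [+ _ _ _ _] := N_poisson.1 _ _ xy; apply.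
by move=> T; exact: (hw ((x, y), T)).
Qed.

Lemma still_componentsP r w : (forall x y, x != y -> mono (N w x y)) ->
  still_components (still r w) <-> finite_components t0 (N w) r.
Proof.
move=> Nmono.
have slab0 s : 0 <= s%:R * t0 by rewrite mulr_ge0// ltW.
have slabS : r%:R * t0 <= r.+1%:R * t0 by rewrite ler_pM2r// ler_nat.
have stillE y z : y != z -> (still r w (y, z) /\ still r w (z, y)) <-> ~~ edge t0 (N w) r y z.
  move=> yz; have zy : z != y by rewrite eq_sym.
  rewrite /still !incr_eventE !addn0 /edge yz /= -leqNgt /sym_path.
  have h1 := Nmono _ _ yz _ _ (slab0 r) slabS.
  have h2 := Nmono _ _ zy _ _ (slab0 r) slabS.
  split=> [[/= -> ->] //|h /=]; split; apply/eqP; rewrite eqn_leq ?h1 ?h2 andbT.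
    by rewrite -(leq_add2r (N w z y (r.+1%:R * t0))); apply: leq_trans h _; rewrite leq_add2l.
  by rewrite -(leq_add2l (N w y z (r.+1%:R * t0))); apply: leq_trans h _; rewrite leq_add2r.
split=> [h|/finite_components_closed h].
  apply/finite_components_closed => x; have [B [xB hB]] := h x; exists B; split=> // y z yB zB.
  have yz : y != z by apply: contraNneq zB => <-.
  by apply/(stillE _ _ yz); exact: hB.
move=> x; have [B [xB hB]] := h x; exists B; split=> // y yB z zB.
have yz : y != z by apply: contraNneq zB => <-.
by apply/(stillE _ _ yz); exact: hB.
Qed.

Hypothesis SEP : {ae P, forall w, finite_components t0 (N w) 0}.

(** Stationarity carries finiteness of the clusters from slab [0] to slab [r]. *)
Lemma ae_finite_components r : {ae P, forall w, finite_components t0 (N w) r}.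
Proof.
have [mr m0 E] := sigma_same_law r still_components_sigma.
have mC s : measurable (still s @^-1` still_components) ->
    P (~` (still s @^-1` still_components)) = 0%E <-> P (still s @^-1` still_components) = 1%E.
  move=> ms; rewrite probability_setC//.
  have fin : P (still s @^-1` still_components) \is a fin_num by rewrite fin_num_measure.
  rewrite -(fineK fin) -EFinB; split=> [[h]|[->]]; last by rewrite subrr.
  by congr EFin; apply/eqP; rewrite eq_sym -subr_eq0 h.
have P0 : P (~` (still 0 @^-1` still_components)) = 0%E.
  have [D [mD D0 hD]] := ae_measurable_core (filterI ae_mono SEP).
  apply/eqP; rewrite eq_le measure_ge0 andbT -D0; apply: le_measure; rewrite ?inE.
  - exact: measurableC.
  - exact: measurableC.
  by apply: subsetC => w /hD[mono_w fc]; apply/still_componentsP.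
have Pr : P (~` (still r @^-1` still_components)) = 0%E.
  by apply/(mC _ mr); rewrite E; apply/(mC _ m0).
have : {ae P, forall w, still_components (still r w)}.
  by exists (~` (still r @^-1` still_components)); split => //; exact: measurableC.
by move=> h; apply: filterS (filterI ae_mono h) => w [mono_w /(still_componentsP _ mono_w)].
Qed.

Lemma ae_Gamma_star : {ae P, forall w, Gamma_star t0 (N w)}.
Proof.
have ae_zero : {ae P, forall w, forall p : S * S, p.1 != p.2 -> N w p.1 p.2 0 = 0%N}.
  apply: ae_forall_countable => p; have [pne|_] := boolP (p.1 != p.2); last by apply: aeW => w.
  have [_ _ h _ _] := N_poisson.1 _ _ pne.
  by apply: filterS h => w /= ->.
have ae_ok : {ae P, forall w, forall QT : {fset S * S} * nat,
    (forall p, p \in QT.1 -> p.1 != p.2) ->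
    exists m : nat, cells_ok (N w) QT.1 (QT.2.+1%:R / m.+1%:R) m.+1}.
  apply: ae_forall_countable => -[Q T] /=.
  have [Qoff|n] := pselect (forall p, p \in Q -> p.1 != p.2); last by apply: aeW => w.
  have := ae_cells_ok c_ge0 N_poisson Qoff (ltr0Sn R T).
  by apply: filterS => w /(_ 0%N)[m _ ok] _; exists m.
have ae_comp : {ae P, forall w, forall r, finite_components t0 (N w) r}.
  by apply: ae_forall_countable => r; exact: ae_finite_components.
apply: filterS (filterI (filterI ae_mono ae_zero) (filterI ae_ok ae_comp)).
move=> w [[mono_w zero_w] [ok_w comp_w]]; apply: Gamma_star_intro => //.
- by move=> x y xy; have [+ _ _ _ _] := N_poisson.1 _ _ xy; apply.
- by move=> x y xy; exact: (zero_w (x, y)).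
- by move=> Q T; exact: (ok_w (Q, T)).
Qed.

End Stationarity.

(** * Influence of distant sites *)

(** Every exchange runs along an edge, hence takes place within [C] or away from it. *)
Lemma chain_agree (R : realType) (S : countType) (K : S -> S -> R -> nat)
    (Q : {fset S * S}) (C : set S) (h : R) (m : nat) :
  (forall x y, x != y -> mono (K x y)) ->
  (forall p, p \in Q -> p.1 != p.2) -> 0 < h ->
  (forall x y, x != y -> (K x y 0%R < K x y (m%:R * h)%R)%N -> C x <-> C y) ->
  forall (s s' : config S), (forall x, C x -> s x = s' x) ->
  forall i, (i <= m)%N -> forall x, C x -> chain K Q h i s x = chain K Q h i s' x.
Proof.
move=> Kmono Qoff h0 Cedge s s' ss'; elim=> [|i IH] im //= x Cx.
have {}IH := IH (ltnW im).
have [[p sp]|none] := pselect (exists p, single K Q (i%:R * h) (i.+1%:R * h) p).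
  rewrite !(cell_map_single _ sp); case: sp => pQ Kp _.
  have a0 : 0 <= i%:R * h by rewrite mulr_ge0// ltW.
  have b0 : 0 <= i.+1%:R * h by rewrite mulr_ge0// ltW.
  have bm : i.+1%:R * h <= m%:R * h by rewrite ler_pM2r// ler_nat.
  have pne := Qoff _ pQ.
  have C12 : C p.1 <-> C p.2.
    apply: Cedge => //; apply: leq_ltn_trans (Kmono _ _ pne _ _ (lexx 0) a0) _.
    by apply: leq_trans (Kmono _ _ pne _ _ b0 bm); rewrite Kp.
  have [C1|nC1] := pselect (C p.1).
    by apply: (@hop_local _ p _ _ C) => //; exact/C12.
  have nC2 : ~ C p.2 by move/C12.
  rewrite !hop_off; first exact: IH.
  - by apply/eqP => E; apply: nC1; rewrite -E.
  - by apply/eqP => E; apply: nC2; rewrite -E.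
  - by apply/eqP => E; apply: nC1; rewrite -E.
  - by apply/eqP => E; apply: nC2; rewrite -E.
by rewrite !cell_map_none//; exact: IH.
Qed.

Section Pool.
Context (S : countType).

Definition pool (n : nat) : {fset S} :=
  [fset x in pmap (@choice.pickle_inv S) (iota 0 n)]%fset.

Lemma in_pool n x : (x \in pool n) = (choice.pickle x < n)%N.
Proof.
rewrite inE mem_pmap; apply/mapP/idP => [[k]|xn].
  rewrite mem_iota add0n /= => kn /esym kx.
  by have := @choice.pickle_invK S k; rewrite kx /= => ->.
by exists (choice.pickle x); rewrite ?mem_iota ?add0n// choice.pickleK_inv.
Qed.

Definition pairs (n : nat) : {fset S * S} :=
  [fset p in [seq (x, y) | x <- pool n, y <- pool n] | p.1 != p.2]%fset.

Lemma in_pairsE n p : (p \in pairs n) =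
  (p \in [seq (x, y) | x <- pool n, y <- pool n]) && (p.1 != p.2).
Proof. by rewrite /pairs in_fset [LHS]inE. Qed.

Lemma in_pairs n p : (p \in pairs n) =
  [&& p.1 \in pool n, p.2 \in pool n & p.1 != p.2].
Proof.
rewrite in_pairsE andbA; congr (_ && _).
apply/allpairsP/andP => [[[x y] [/= xn yn ->]]|[h1 h2]] //.
by exists p; rewrite -surjective_pairing.
Qed.

Lemma pairs_off n p : p \in pairs n -> p.1 != p.2.
Proof. by rewrite in_pairs => /and3P[]. Qed.

Lemma pool_sub m n x : (m <= n)%N -> x \in pool m -> x \in pool n.
Proof. by rewrite !in_pool => mn /leq_trans; apply. Qed.

Lemma pairs_sub m n p : (m <= n)%N -> p \in pairs m -> p \in pairs n.
Proof.
by rewrite !in_pairs => mn /and3P[h1 h2 ->]; rewrite !(pool_sub mn).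
Qed.

Lemma pool_exhausts (A : {fset S}) : exists n, forall x, x \in A -> x \in pool n.
Proof.
exists (\max_(x <- A) choice.pickle x).+1 => x xA.
by rewrite in_pool ltnS; exact: leq_bigmax_seq.
Qed.

Lemma sum_pairs (R : realType) n (F : S * S -> R) : \sum_(p <- pairs n) F p =
  \sum_(x <- pool n) \sum_(y <- pool n | x != y) F (x, y).
Proof.
have -> : \sum_(p <- pairs n) F p =
    \sum_(p <- [seq (x, y) | x <- pool n, y <- pool n] | p.1 != p.2) F p.
  rewrite -[RHS]big_filter; apply: perm_big; apply: uniq_perm.
  - exact: fset_uniq.
  - by rewrite filter_uniq// allpairs_uniq// ?fset_uniq// => -[? ?] [? ?] _ _ /= [-> ->].
  - by move=> p; rewrite mem_filter andbC in_pairsE.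
rewrite big_mkcond big_allpairs_dep /=; apply: eq_bigr => x _.
by rewrite [RHS]big_mkcond.
Qed.

End Pool.

Section Influence.
Context d (Omega : measurableType d) (R : realType) (P : probability Omega R).
Context (S : countType) (c : S -> S -> R) (N : Omega -> S -> S -> R -> nat).
Hypothesis c_ge0 : forall x y, 0 <= c x y.
Hypothesis N_poisson : poisson_family P c N.
Variable t0 : R.
Hypothesis t0_gt0 : 0 < t0.
Implicit Types (s : config S) (A : {fset S}) (a x y z : S).

Definition comp_event a z : set Omega := [set w | component t0 (N w) 0 a z].

Lemma value_measurable x y t n : x != y -> 0 <= t ->
  measurable [set w | N w x y t = n].
Proof.
move=> xy t_ge0; have [_ mX _ _ _] := N_poisson.1 _ _ xy.
by rewrite -[X in measurable X]setTI; apply: (mX t t_ge0 measurableT [set n]).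
Qed.

Lemma edge_measurable x y : measurable [set w | edge t0 (N w) 0 x y].
Proof.
have [xy|/negP xy] := boolP (x != y); last first.
  by rewrite [X in measurable X](_ : _ = set0)// -subset0 => w /andP[/xy].
have yx : y != x by rewrite eq_sym.
rewrite [X in measurable X](_ : _ = [set w | exists k : (nat * nat) * (nat * nat),
  (k.1.1 + k.1.2 < k.2.1 + k.2.2)%N /\
  ([set w | N w x y (0%:R * t0) = k.1.1] `&` [set w | N w y x (0%:R * t0) = k.1.2] `&`
   ([set w | N w x y (1%:R * t0) = k.2.1] `&` [set w | N w y x (1%:R * t0) = k.2.2])) w]).
  apply: measurable_exists => k; apply: measurable_and.
  by apply: measurableI; apply: measurableI; apply: value_measurable => //;
    rewrite mulr_ge0// ltW.
apply/seteqP; split=> w.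
  move=> /andP[_ h]; exists ((N w x y (0%:R * t0), N w y x (0%:R * t0)),
    (N w x y (1%:R * t0), N w y x (1%:R * t0))); split=> //.
by move=> [k [h [[h1 h2] [h3 h4]]]]; rewrite /= /edge xy /sym_path h1 h2 h3 h4.
Qed.

Lemma comp_event_measurable a z : measurable (comp_event a z).
Proof.
have mpath x (p : seq S) : measurable [set w | path (edge t0 (N w) 0) x p].
  elim: p x => [|y p IH] x /=; first by rewrite [X in measurable X](_ : _ = setT)//; apply/seteqP; split.
  rewrite [X in measurable X](_ : _ = [set w | edge t0 (N w) 0 x y] `&`
      [set w | path (edge t0 (N w) 0) y p]).
    by apply: measurableI => //; exact: edge_measurable.
  by apply/seteqP; split=> w /= /andP.
rewrite [X in measurable X](_ : _ = [set w | exists p : seq S,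
  z = last a p /\ [set w | path (edge t0 (N w) 0) a p] w]).
  by apply: measurable_exists => p; apply: measurable_and.
by apply/seteqP; split=> w [p]; [move=> h1 h2; exists p|move=> [h1 h2]; exists p].
Qed.

(** The probability that the value of the configuration at [z] at time [0] can
    be felt at [a] at time [t0]. *)
Definition influence a z : R := fine (P (comp_event a z)).

(** A union bound, up to a factor, for the influence on a function of the sites of
    [A] of an exchange along [p]. *)
Definition sensitivity A (p : S * S) : R :=
  \sum_(a <- A) (influence a p.1 + influence a p.2).

Lemma influence_ge0 a z : 0 <= influence a z.
Proof. exact: fine_ge0. Qed.

Lemma sensitivity_ge0 A p : 0 <= sensitivity A p.
Proof. by apply: sumr_ge0 => a _; rewrite addr_ge0 ?influence_ge0. Qed.

Lemma edge_of_jump K x y t : (forall x y, x != y -> mono (K x y)) -> x != y ->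
  0 <= t -> t <= t0 -> (K x y 0%R < K x y t)%N -> edge t0 K 0 x y.
Proof.
move=> Kmono xy t_ge0 tt0 h; rewrite /edge xy /= mul0r mul1r /sym_path.
have yx : y != x by rewrite eq_sym.
rewrite -addSn; apply: leq_add.
  by apply: leq_trans h _; apply: Kmono.
by apply: Kmono => //; exact: ltW.
Qed.

Hypothesis SEP : {ae P, forall w, finite_components t0 (N w) 0}.

Lemma good_core : exists D, [/\ measurable D, P (~` D) = 0%E &
  forall w, D w -> Gamma_star t0 (N w) /\ forall x y, x != y -> mono (N w x y)].
Proof.
apply: ae_measurable_core.
exact: filterI (ae_Gamma_star c_ge0 N_poisson t0_gt0 SEP) (ae_mono c_ge0 N_poisson).
Qed.

Lemma integrable_indic_sum (I : Type) (r : seq I) (k : R) (E : I -> set Omega) (D : set Omega) :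
  measurable D -> (forall i, measurable (E i)) ->
  P.-integrable D (EFin \o (fun w => k * \sum_(i <- r) \1_(E i) w)).
Proof.
move=> mD mE.
apply: (@bounded_integrable _ _ _ _ _ _ (`|k| * \sum_(i <- r) 1)) => //.
  apply: measurable_funM => //; apply: measurable_sum => i; exact: measurable_indic.
move=> w _; rewrite normrM ler_wpM2l//; apply: le_trans (ler_norm_sum _ _ _) _.
by apply: ler_sum => i _; rewrite indicE; case: (_ \in _); rewrite ?normr1 ?normr0.
Qed.

(** Coupling: run the dynamics from [s] and from [hop p s] with the same jumps. They
    agree on [A] unless the cluster of some site of [A] meets the pair [p]. *)
Lemma influence_bound (x0 : S) A (Q : {fset S * S}) h i (f : config S -> R) (F : R) s p :
  (forall p, p \in Q -> p.1 != p.2) -> 0 < h -> i%:R * h <= t0 ->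
  (forall s s', (forall x, x \in A -> s x = s' x) -> f s = f s') ->
  (forall s, `|f s| <= F) ->
  `|iter i (average Q (cell_rate c Q h)) f (hop p s) -
    iter i (average Q (cell_rate c Q h)) f s| <= 2 * F * sensitivity A p.
Proof.
move=> Qoff h0 iht floc fF.
have [D [mD D0 hD]] := good_core.
have F0 : 0 <= F by apply: le_trans (fF point).
have mchain s' E : measurable_fun E (fun w => f (chain (N w) Q h i s')).
  by apply: measurable_funTS; exact: (chain_measurable N_poisson).
have ichain s' : P.-integrable D (EFin \o (fun w => f (chain (N w) Q h i s'))).
  exact: (@bounded_integrable _ _ _ _ _ _ F).
have E s' : iter i (average Q (cell_rate c Q h)) f s' =
    \int[P]_(w in D) f (chain (N w) Q h i s').
  rewrite -(chain_expectation N_poisson x0 Qoff h0 s' i fF).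
  exact: (Rintegral_full_subset _ mD D0 (@subsetT _ D)).
rewrite !E -RintegralB//.
apply: le_trans (le_normr_Rintegral _ _) _ => //.
  apply: (@bounded_integrable _ _ _ _ _ _ (F + F)) => //.
    exact: measurable_funB.
  by move=> w _; apply: le_trans (ler_normB _ _) _; apply: lerD.
pose G w := 2 * F * \sum_(a <- A) \1_(comp_event a p.1) w +
            2 * F * \sum_(a <- A) \1_(comp_event a p.2) w.
have iG (z : S) (E' : set Omega) : measurable E' -> P.-integrable E'
    (EFin \o (fun w => 2 * F * \sum_(a <- A) \1_(comp_event a z) w)).
  by move=> mE'; apply: integrable_indic_sum => // a; exact: comp_event_measurable.
apply: (@le_trans _ _ (\int[P]_(w in D) G w)).
  apply: le_Rintegral => //.
  - apply: (@bounded_integrable _ _ _ _ _ _ (F + F)) => //.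
      by apply: measurableT_comp => //; exact: measurable_funB.
    by move=> w _; rewrite normr_id; apply: le_trans (ler_normB _ _) _; apply: lerD.
  - rewrite (_ : _ \o _ = ((EFin \o (fun w => (2 * F * \sum_(a <- A) \1_(comp_event a p.1) w)%R))
      \+ (EFin \o (fun w => (2 * F * \sum_(a <- A) \1_(comp_event a p.2) w)%R)))%E) //.
    exact: (integrableD mD (iG _ _ mD) (iG _ _ mD)).
  move=> w Dw; have [_ Nmono] := hD w Dw.
  have sum0 z : 0 <= \sum_(a <- A) (\1_(comp_event a z) w : R).
    by apply: sumr_ge0 => a _; rewrite indicE.
  have [[a aA az]|none] := pselect (exists2 a, a \in A &
      component t0 (N w) 0 a p.1 \/ component t0 (N w) 0 a p.2).
    apply: (@le_trans _ _ (2 * F)).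
      by apply: le_trans (ler_normB _ _) _; rewrite mulr_natl mulr2n lerD.
    have one z : component t0 (N w) 0 a z -> 1 <= \sum_(a <- A) (\1_(comp_event a z) w : R).
      move=> az'; rewrite (big_rem a aA) /= indicE mem_set// lerDl.
      by apply: sumr_ge0 => b _; rewrite indicE.
    rewrite /G -mulrDr ler_peMr ?mulr_ge0//.
    by case: az => /one az'; [apply: ler_wpDr|apply: ler_wpDl].
  rewrite (_ : f _ = f (chain (N w) Q h i s)); last first.
    apply: floc => a aA; apply: (@chain_agree _ _ _ _ (component t0 (N w) 0 a) h i) => //.
    - move=> x y xy Kxy; apply: component_edge_iff.
      by apply: edge_of_jump Kxy => //; rewrite mulr_ge0// ltW.
    - move=> x ax; apply: hop_off; apply/eqP => xp; apply: none; exists a => //.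
        by left; rewrite -xp.
      by right; rewrite -xp.
    - exact: component_refl.
  by rewrite subrr normr0 addr_ge0// mulr_ge0// mulr_ge0.
rewrite -(Rintegral_full_subset _ mD D0 (@subsetT _ D)) /G RintegralD//; try exact: iG.
have EI z : \int[P]_w (2 * F * \sum_(a <- A) \1_(comp_event a z) w) =
    2 * F * \sum_(a <- A) influence a z.
  have iI (a : S) : P.-integrable setT (EFin \o (\1_(comp_event a z) : Omega -> R)).
    by apply: integrable_indicator => //; exact: comp_event_measurable.
  rewrite RintegralZl//; last exact: integrable_bigsum.
  rewrite Rintegral_sum//; congr (_ * _); apply: eq_bigr => a _.
  by rewrite Rintegral_indicator//; exact: comp_event_measurable.
by rewrite !EI -mulrDr -big_split.
Qed.

(** The part within the first sites of the sum that controls the action of the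
    generator on functions with sensitivity at most that of [A]. *)
Definition energy A n : R :=
  \sum_(p <- pairs S n) c p.1 p.2 * sensitivity A p.

Lemma energy_nondecreasing A : nondecreasing_seq (energy A).
Proof.
move=> m n mn; rewrite /energy.
have sub : {subset pairs S m <= pairs S n} by move=> p; exact: pairs_sub.
have -> : \sum_(p <- pairs S m) c p.1 p.2 * sensitivity A p =
    \sum_(p <- pairs S n | p \in pairs S m) c p.1 p.2 * sensitivity A p.
  rewrite -[RHS]big_filter; apply: perm_big; apply: uniq_perm.
  - exact: fset_uniq.
  - by rewrite filter_uniq// fset_uniq.
  - by move=> p; rewrite mem_filter; case: (boolP (p \in pairs S m)) => //= /sub ->.
rewrite [leRHS](bigID (fun p => p \in pairs S m)) /= lerDl.
by apply: sumr_ge0 => p _; rewrite mulr_ge0// sensitivity_ge0.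
Qed.

Hypothesis rate_integrable : forall x,
  (\int[P]_(w in graphical_event N t0)
     (\esum_(z in influence_set t0 (N w) t0 x) total_rate c z) < +oo)%E.

(** Each pair touching the cluster of [a] is counted once from each endpoint in
    the total rates of the sites of the cluster. *)
Lemma energy1_bounded a : exists B : R, forall n,
  \sum_(p <- pairs S n) c p.1 p.2 * (influence a p.1 + influence a p.2) <= B.
Proof.
have [D [mD D0 hD]] := good_core.
have I0 : (0 <= \int[P]_(w in D) (\esum_(z in component t0 (N w) 0 a) total_rate c z))%E.
  apply: integral_ge0 => w _; apply: esum_ge0 => z _; apply: esum_ge0 => y _.
  by rewrite lee_fin addr_ge0.
have fI : (\int[P]_(w in D) (\esum_(z in component t0 (N w) 0 a) total_rate c z) < +oo)%E.
  rewrite -(@integral_full_subset _ _ _ P _ D (graphical_event N t0))//; last first.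
    by move=> w /hD[].
  by have := rate_integrable a; under eq_integral do rewrite influence_set_first//.
exists (fine (\int[P]_(w in D) (\esum_(z in component t0 (N w) 0 a) total_rate c z))%E) => n.
rewrite -lee_fin fineK ?ge0_fin_numE//.
pose k z := \sum_(y <- pool S n) (c z y + c y z).
have k0 z : 0 <= k z by apply: sumr_ge0 => y _; rewrite addr_ge0.
pose F w := \sum_(z <- pool S n) k z * \1_(comp_event a z) w.
have iI (z : S) (E : set Omega) : measurable E ->
    P.-integrable E (EFin \o (fun w => k z * \1_(comp_event a z) w)).
  move=> mE; apply: (@bounded_integrable _ _ _ _ _ _ (k z)) => //.
    apply: measurable_funM => //; apply: measurable_indic; exact: comp_event_measurable.
  by move=> w _; rewrite indicE; case: (_ \in _); rewrite ?mulr1 ?mulr0 ?normr0// ger0_norm.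
have EF : \int[P]_(w in D) F w = \sum_(z <- pool S n) k z * influence a z.
  rewrite -(Rintegral_full_subset _ mD D0 (@subsetT _ D)) /F Rintegral_sum//; last first.
    by move=> z; exact: iI.
  apply: eq_bigr => z _; rewrite RintegralZl//.
    by rewrite Rintegral_indicator//; exact: comp_event_measurable.
  by apply: integrable_indicator => //; exact: comp_event_measurable.
apply: (@le_trans _ _ (\int[P]_(w in D) (F w)%:E)%E); last first.
  apply: le_ge0_integral => w Dw.
    by rewrite lee_fin sumr_ge0// => z _; rewrite mulr_ge0.
  have [[/(_ 0%N a) fin _ _ _ _] _] := hD w Dw.
  have k_le z : ((k z)%:E <= total_rate c z)%E.
    apply: esum_ge; exists [set` pool S n]; first by split.
    by rewrite -fsbig_seq ?fset_uniq// sumEFin.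
  pose r := [seq z <- pool S n | `[< component t0 (N w) 0 a z >]].
  apply: esum_ge; exists [set` r].
    by split; [exact: finite_seq|move=> z; rewrite /= mem_filter => /andP[/asboolP]].
  rewrite -fsbig_seq ?filter_uniq ?fset_uniq// big_filter -sumEFin [leRHS]big_mkcond.
  apply: lee_sum => z _; rewrite indicE; case: asboolP => h.
    by rewrite mem_set// mulr1.
  by rewrite memNset// mulr0.
have iF : P.-integrable D (EFin \o F) by apply: integrable_bigsum => // z; exact: iI.
rewrite -(fineK (integrable_fin_num mD iF)) lee_fin -[leRHS]/(Rintegral P D F) EF.
rewrite sum_pairs /=.
apply: (@le_trans _ _ (\sum_(x <- pool S n) \sum_(y <- pool S n)
    c x y * (influence a x + influence a y))).
  apply: ler_sum => x _; rewrite [leRHS](bigID (fun y => x != y)) /= lerDl.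
  by apply: sumr_ge0 => y _; rewrite mulr_ge0// addr_ge0 ?influence_ge0.
rewrite le_eqVlt; apply/orP; left; apply/eqP.
transitivity (\sum_(x <- pool S n) \sum_(y <- pool S n) c x y * influence a x +
    \sum_(x <- pool S n) \sum_(y <- pool S n) c y x * influence a x).
  rewrite [X in _ = _ + X]exchange_big -big_split /=; apply: eq_bigr => x _.
  by rewrite -big_split /=; apply: eq_bigr => y _; rewrite mulrDr.
rewrite -big_split /=; apply: eq_bigr => x _.
by rewrite -big_split /= mulr_suml; apply: eq_bigr => y _; rewrite mulrDl.
Qed.

Lemma energy_bounded A : exists B : R, forall n, energy A n <= B.
Proof.
have /choice[B hB] : forall a, exists B : R, forall n,
    \sum_(p <- pairs S n) c p.1 p.2 * (influence a p.1 + influence a p.2) <= B.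
  exact: energy1_bounded.
exists (\sum_(a <- A) B a) => n; rewrite /energy.
under eq_bigr do rewrite /sensitivity mulr_sumr.
by rewrite exchange_big /=; apply: ler_sum => a _; exact: hB.
Qed.

End Influence.

(** * The semigroup as a limit of iterated averages *)

Section SemigroupApproximation.
Context d (Omega : measurableType d) (R : realType) (P : probability Omega R).
Context (S : countType) (c : S -> S -> R) (N : Omega -> S -> S -> R -> nat).
Hypothesis c_ge0 : forall x y, 0 <= c x y.
Hypothesis N_poisson : poisson_family P c N.
Variable t0 : R.
Hypothesis t0_gt0 : 0 < t0.
Hypothesis SEP : {ae P, forall w, finite_components t0 (N w) 0}.
Variable x0 : S.
Implicit Types (s : config S) (A : {fset S}) (f g : config S -> R) (t : R).

Definition local_on A f := forall s s', (forall x, x \in A -> s x = s' x) -> f s = f s'.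

Definition leave A (n : nat) : set Omega :=
  [set w | exists a, a \in A /\ exists z, z \notin pool S n /\ comp_event N t0 a z w].

Lemma leave_measurable A n : measurable (leave A n).
Proof.
apply: measurable_exists => a; apply: measurable_and.
apply: measurable_exists => z; apply: measurable_and.
exact: (comp_event_measurable N_poisson).
Qed.

Lemma leave_sub A m n : (m <= n)%N -> leave A n `<=` leave A m.
Proof.
move=> mn w [a [aA [z [zn az]]]]; exists a; split=> //; exists z; split=> //.
by apply: contra zn; exact: pool_sub.
Qed.

(** The clusters of [A] are almost surely finite, so these events decrease to a null
    set. *)
Lemma leave_vanishes A (e : R) : 0 < e -> exists n0, forall n, (n0 <= n)%N ->
  fine (P (leave A n)) <= e.
Proof.
move=> e0; have [D [mD D0 hD]] := good_core c_ge0 N_poisson t0_gt0 SEP.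
have mcap : measurable (\bigcap_n leave A n).
  by apply: bigcapT_measurable => n; exact: leave_measurable.
have cap0 : P (\bigcap_n leave A n) = 0%E.
  apply/eqP; rewrite eq_le measure_ge0 andbT -D0; apply: le_measure; rewrite ?inE//.
    exact: measurableC.
  move=> w hw Dw; have [[/(_ 0%N) fin _ _ _ _] _] := hD w Dw.
  pose X := \bigcup_(a in [set` A]) component t0 (N w) 0 a.
  have fX : finite_set X by apply: bigcup_finite => // a _; exact: fin.
  have [n hn] := pool_exhausts (fset_set X).
  have [a [aA [z [zn az]]]] := hw n I.
  by case/negP: zn; apply: hn; rewrite in_fset_set//; apply/mem_set; exists a.
have cv : P (leave A n) @[n --> \oo] --> P (\bigcap_n leave A n).
  apply: nonincreasing_cvg_mu => //.
  - by apply: le_lt_trans (probability_le1 _ _) _; rewrite ?ltry//; exact: leave_measurable.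
  - by move=> n; exact: leave_measurable.
  - by move=> m n mn; apply/subsetPset; exact: leave_sub.
rewrite cap0 in cv.
have /fine_cvgP[_ /cvgrPdist_le /(_ e e0) [n0 _ hn0]] := cv.
exists n0 => n nn0; have := hn0 n nn0; rewrite /= sub0r normrN ger0_norm//.
exact: fine_ge0.
Qed.

Lemma eta_chain A n m t s w : (forall x y, x != y -> mono (N w x y)) ->
  0 < t -> t <= t0 -> ~ leave A n w ->
  finite_components t0 (N w) 0 ->
  cells_ok (N w) (pairs S n) (t / m.+1%:R) m.+1 ->
  forall a, a \in A ->
  eta t0 (N w) s t a = chain (N w) (pairs S n) (t / m.+1%:R) m.+1 s a.
Proof.
move=> Nmono t_gt0 tt0 nleave fin ok a aA.
rewrite eta_first//.
have tE : m.+1%:R * (t / m.+1%:R) = t by rewrite mulrC divfK// pnatr_eq0.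
have inpool x : component t0 (N w) 0 a x -> x \in pool S n.
  move=> ax; apply: contraT => xn; case: nleave; exists a; split=> //.
  by exists x.
have := @graphical_chain R S (N w) (pairs S n) (component t0 (N w) 0 a) Nmono _ _ _
  (t / m.+1%:R) m.+1 s _ ok _ m.+1 (leqnn _).
rewrite tE => h; apply: (h _ _ _ _ _).2.
- by move=> x y xy; have [+ _ _ _ _] := N_poisson.1 _ _ xy; apply.
- exact: pairs_off.
- by move=> x y ax ay xy; rewrite in_pairs /= !inpool.
- by rewrite divr_gt0.
- move=> x y xy Kxy; apply: component_edge_iff.
  by apply: edge_of_jump Kxy => //; exact: ltW.
- exact: component_refl.
Qed.

Lemma good_core_at t : 0 < t -> exists D, [/\ measurable D, P (~` D) = 0%E &
  forall w, D w -> [/\ Gamma_star t0 (N w), (forall x y, x != y -> mono (N w x y)) &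
    forall n, exists m, cells_ok (N w) (pairs S n) (t / m.+1%:R) m.+1]].
Proof.
move=> t_gt0; apply: ae_measurable_core.
have ae_ok : {ae P, forall w, forall n,
    exists m, cells_ok (N w) (pairs S n) (t / m.+1%:R) m.+1}.
  apply: ae_forall_countable => n.
  have := ae_cells_ok c_ge0 N_poisson (@pairs_off S n) t_gt0.
  by apply: filterS => w /(_ 0%N)[m _ ok]; exists m.
apply: filterS (filterI ae_ok (filterI (ae_Gamma_star c_ge0 N_poisson t0_gt0 SEP)
  (ae_mono c_ge0 N_poisson))).
by move=> w [h1 [h2 h3]].
Qed.

(** Up to countably many good events, [f (eta t0 (N w) s t)] is a function of finitely
    many increments. *)
Lemma eta_measurable A f t s D : local_on A f -> 0 < t -> t <= t0 -> measurable D ->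
  (forall w, D w -> [/\ Gamma_star t0 (N w), (forall x y, x != y -> mono (N w x y)) &
    forall n, exists m, cells_ok (N w) (pairs S n) (t / m.+1%:R) m.+1]) ->
  measurable_fun D (fun w => f (eta t0 (N w) s t)).
Proof.
move=> floc t_gt0 tt0 mD hD.
pose G n m := D `&` ~` leave A n `&` cells_event N (pairs S n) (t / m.+1%:R) m.+1.
have mG n m : measurable (G n m).
  apply: measurableI; first by apply: measurableI => //; apply/measurableC/leave_measurable.
  apply: (cells_event_measurable N_poisson (@pairs_off S n)).
  by rewrite divr_gt0.
have DE : D = \bigcup_n \bigcup_m G n m.
  apply/seteqP; split=> [w Dw|w [n _ [m _ [[]]]]//].
  have [[/(_ 0%N) fin _ _ _ _] _ ok] := hD w Dw.
  pose X := \bigcup_(a in [set` A]) component t0 (N w) 0 a.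
  have fX : finite_set X by apply: bigcup_finite => // a _; exact: fin.
  have [n hn] := pool_exhausts (fset_set X).
  have [m okm] := ok n; exists n => //; exists m => //; split => //; split => //.
  move=> [a [aA [z [zn az]]]]; case/negP: zn; apply: hn.
  by rewrite in_fset_set//; apply/mem_set; exists a.
rewrite DE; apply/measurable_fun_bigcup => [n|n]; first exact: bigcupT_measurable.
apply/measurable_fun_bigcup => // m.
apply: (@eq_measurable_fun _ _ _ _ _
  (fun w => f (chain (N w) (pairs S n) (t / m.+1%:R) m.+1 s))).
  move=> w /set_mem [[Dw nl] ok]; have [[/(_ 0%N) fin _ _ _ _] Nmono _] := hD w Dw.
  by apply: floc => a aA; rewrite (@eta_chain A n m).
apply: measurable_funTS; apply: (chain_measurable N_poisson).
- exact: pairs_off.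
- by rewrite divr_gt0.
Qed.

Lemma semigroup_approx A f (F : R) t n m s : local_on A f -> (forall s, `|f s| <= F) ->
  0 < t -> t <= t0 ->
  `|semigroup P N t0 t f s -
    iter m.+1 (average (pairs S n) (cell_rate c (pairs S n) (t / m.+1%:R))) f s| <=
  2 * F * (fine (P (leave A n)) +
           fine (P (~` cells_event N (pairs S n) (t / m.+1%:R) m.+1))).
Proof.
move=> floc fF t_gt0 tt0.
have [D [mD D0 hD]] := good_core_at t_gt0.
have h0 : 0 < t / m.+1%:R by rewrite divr_gt0.
have F0 : 0 <= F by apply: le_trans (fF point).
have Qoff := @pairs_off S n.
have mchain E : measurable_fun E (fun w => f (chain (N w) (pairs S n) (t / m.+1%:R) m.+1 s)).
  by apply: measurable_funTS; exact: (chain_measurable N_poisson).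
have meta := eta_measurable s floc t_gt0 tt0 mD hD.
rewrite -(chain_expectation N_poisson x0 Qoff h0 s m.+1 fF).
rewrite (Rintegral_full_subset _ mD D0 (@subsetT _ D)).
rewrite /semigroup (@Rintegral_full_subset _ _ _ P _ D (graphical_event N t0))//; last first.
  by move=> w /hD[].
rewrite -RintegralB//; last 2 first.
- exact: (@bounded_integrable _ _ _ _ _ _ F).
- exact: (@bounded_integrable _ _ _ _ _ _ F).
have idiff : P.-integrable D (EFin \o (fun w => f (eta t0 (N w) s t) -
    f (chain (N w) (pairs S n) (t / m.+1%:R) m.+1 s))).
  apply: (@bounded_integrable _ _ _ _ _ _ (F + F)) => //; first exact: measurable_funB.
  by move=> w _; apply: le_trans (ler_normB _ _) _; apply: lerD.
apply: le_trans (le_normr_Rintegral _ _) _ => //.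
set B2 := ~` cells_event _ _ _ _.
have mB2 : measurable B2.
  by apply: measurableC; exact: (cells_event_measurable N_poisson).
have mB1 := leave_measurable A n.
have iB (B E : set Omega) : measurable E -> measurable B ->
    P.-integrable E (EFin \o (\1_B : Omega -> R)).
  exact: integrable_indicator.
have iBZ (B E : set Omega) : measurable E -> measurable B ->
    P.-integrable E (EFin \o (fun w => 2 * F * \1_B w)).
  move=> mE mB; apply: (@bounded_integrable _ _ _ _ _ _ (2 * F)) => //.
    by apply: measurable_funM.
  by move=> w _; rewrite indicE; case: (_ \in _); rewrite ?mulr1 ?mulr0 ?normr0 ?ger0_norm ?mulr_ge0.
apply: (@le_trans _ _ (\int[P]_(w in D) (2 * F * \1_(leave A n) w + 2 * F * \1_B2 w))).
  apply: le_Rintegral => //.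
  - exact: integrable_norm.
  - rewrite (_ : _ \o _ = ((EFin \o (fun w => (2 * F * \1_(leave A n) w)%R))
      \+ (EFin \o (fun w => (2 * F * \1_B2 w)%R)))%E) //.
    by apply: integrableD => //; exact: iBZ.
  move=> w Dw; have [[/(_ 0%N) fin _ _ _ _] Nmono _] := hD w Dw.
  have bnd : `|f (eta t0 (N w) s t) - f (chain (N w) (pairs S n) (t / m.+1%:R) m.+1 s)| <= 2 * F.
    by apply: le_trans (ler_normB _ _) _; rewrite mulr_natl mulr2n lerD.
  have ind0 (B : set Omega) : 0 <= 2 * F * \1_B w :> R by rewrite !mulr_ge0 ?indicE.
  have [l|nl] := pselect (leave A n w).
    by rewrite [\1_(leave A n) w]indicE mem_set// mulr1 (le_trans bnd)// lerDl.
  have [b|nb] := pselect (B2 w).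
    by rewrite [\1_B2 w]indicE mem_set// mulr1 (le_trans bnd)// lerDr.
  have ok : cells_ok (N w) (pairs S n) (t / m.+1%:R) m.+1 by exact: contrapT.
  rewrite (floc _ _ (@eta_chain A n m t s w Nmono t_gt0 tt0 nl fin ok)) subrr normr0.
  exact: addr_ge0.
rewrite -(Rintegral_full_subset _ mD D0 (@subsetT _ D)) RintegralD//; try exact: iBZ.
by rewrite !RintegralZl ?Rintegral_indicator -?mulrDr//; exact: iB.
Qed.

(** The number of sites is fixed before the grid is refined: the grid error depends
    on the total rate of the pairs kept. *)
Lemma semigroup_scheme A f (F : R) t (e : R) : local_on A f ->
  (forall s, `|f s| <= F) -> 0 < t -> t <= t0 -> 0 < e ->
  exists n1, forall n, (n1 <= n)%N -> exists m1, forall m, (m1 <= m)%N -> forall s,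
    `|semigroup P N t0 t f s -
    iter m.+1 (average (pairs S n) (cell_rate c (pairs S n) (t / m.+1%:R))) f s| <= e.
Proof.
move=> floc fF t_gt0 tt0 e0.
have F0 : 0 <= F by apply: le_trans (fF point).
pose e' := e / (2 * (2 * F + 1)).
have den : 0 < 2 * (2 * F + 1) by rewrite mulr_gt0// ltr_wpDl// mulr_ge0.
have e'0 : 0 < e' by rewrite divr_gt0.
have [n1 hn1] := leave_vanishes A e'0.
exists n1 => n nn1.
pose C := (t * total c (pairs S n)) ^+ 2.
exists (Num.truncn (C / e')) => m m1 s.
apply: le_trans (semigroup_approx n m s floc fF t_gt0 tt0) _.
have b2 : fine (P (~` cells_event N (pairs S n) (t / m.+1%:R) m.+1)) <= e'.
  have := P_grid_bad c_ge0 N_poisson (@pairs_off S n) m t_gt0.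
  set p := P _ => hp; have fp : p \is a fin_num.
    rewrite fin_num_measure//; apply/measurableC/(cells_event_measurable N_poisson).
      exact: pairs_off.
    by rewrite divr_gt0.
  rewrite -(fineK fp) lee_fin in hp; apply: le_trans hp _.
  rewrite ler_pdivrMr// [leRHS]mulrC -ler_pdivrMr// -/C.
  apply: le_trans (ltW (truncnS_gt _)) _.
  by rewrite ler_nat ltnS.
apply: (@le_trans _ _ (2 * F * (e' + e'))).
  by rewrite ler_wpM2l ?mulr_ge0// lerD// hn1.
have -> : e = 2 * (2 * F + 1) * e' by rewrite /e' mulrC divfK// gt_eqF.
nra.
Qed.

(** The measurability hypothesis is the one that passes from local functions to their
    pointwise limits, and so holds for continuous functions. *)
Lemma semigroup_contraction g g' t (e M M' : R) s :
  (forall s, `|g s| <= M) -> (forall s, `|g' s| <= M') ->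
  (forall D, measurable D ->
    (forall A f, local_on A f -> measurable_fun D (fun w => f (eta t0 (N w) s t))) ->
    measurable_fun D (fun w => g (eta t0 (N w) s t)) /\
    measurable_fun D (fun w => g' (eta t0 (N w) s t))) ->
  0 < t -> t <= t0 -> (forall s, `|g s - g' s| <= e) ->
  `|semigroup P N t0 t g s - semigroup P N t0 t g' s| <= e.
Proof.
move=> gM gM' meas t_gt0 tt0 gg'.
have [D [mD D0 hD]] := good_core_at t_gt0.
have [mg mg'] := meas D mD (fun A f floc => eta_measurable s floc t_gt0 tt0 mD hD).
have DG : D `<=` graphical_event N t0 by move=> w /hD[].
rewrite /semigroup !(Rintegral_full_subset _ mD D0 DG) -RintegralB//; last 2 first.
- exact: (@bounded_integrable _ _ _ _ _ _ M).
- exact: (@bounded_integrable _ _ _ _ _ _ M').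
have mB : measurable_fun D (fun w => g (eta t0 (N w) s t) - g' (eta t0 (N w) s t)).
  exact: measurable_funB.
have iB : P.-integrable D (EFin \o (fun w => g (eta t0 (N w) s t) - g' (eta t0 (N w) s t))).
  by apply: (@bounded_integrable _ _ _ _ _ _ e) => //.
apply: le_trans (le_normr_Rintegral _ _) _ => //.
apply: (@le_trans _ _ (\int[P]_(w in D) e)).
  apply: le_Rintegral => //; first exact: integrable_norm.
  by apply: (@bounded_integrable _ _ _ _ _ _ `|e|) => //; exact: measurable_cst.
rewrite Rintegral_cst// ler_piMr//; first by apply: le_trans (gg' s).
by rewrite -lee_fin fineK ?fin_num_measure// probability_le1.
Qed.

End SemigroupApproximation.

(** * Topology of the space of configurations *)

Section ConfigTopology.
Context (R : realType) (S : countType).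
Implicit Types (s : config S) (f g : config S -> R).

Lemma config_cvg (F : set_system (config S)) s : Filter F ->
  (forall x, \forall s' \near F, s' x = s x) -> F --> s.
Proof.
move=> FF h; apply/cvg_sup => x.
rewrite cvg_image; last by rewrite eqEsubset; split=> v // _; exists (fun=> v).
move=> W /= /nbhs_singleton Ws; exists ((fun s' : config S => s' x) @^-1` W).
  by apply: filterS (h x) => s' /= ->.
by rewrite eqEsubset; split => [j [? + <-//]|j Wj]; exists (fun=> j).
Qed.

Lemma config_near x s : \forall s' \near s, s' x = s x.
Proof.
have := @proj_continuous S (fun=> bool) x s.
by move=> /(_ [set s x]); apply; rewrite /proj nbhs_principalE; exact/principal_filterP.
Qed.

Lemma config_near_fset (A : {fset S}) s :
  \forall s' \near s, forall x, x \in A -> s' x = s x.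
Proof.
have H (r : seq S) : \forall s' \near s, forall x, x \in r -> s' x = s x.
  elim: r => [|x r IH]; first by apply: (@nearW _ _ _ (nbhs_filter s)) => s' x; rewrite in_nil.
  apply: filterS (filterI (config_near x s) IH) => s' [h1 h2] y.
  by rewrite inE => /orP[/eqP->|/h2].
exact: H.
Qed.

Lemma local_continuous (A : {fset S}) f : local_on A f -> continuous f.
Proof.
move=> floc s; apply: cvg_near_cst.
by apply: filterS (config_near_fset A s) => s' h; apply: floc.
Qed.

Lemma config_compact : compact [set: config S].
Proof.
have := @tychonoff S (fun=> bool) (fun=> setT) (fun=> bool_compact).
by rewrite (_ : [set f | _] = setT)//; apply/seteqP; split.
Qed.

Definition trunc n s : config S := fun x => s x && (x \in pool S n).

Lemma trunc_local n f : local_on (pool S n) (f \o trunc n).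
Proof.
move=> s s' ss'; rewrite /=; congr f; apply/funext => x; rewrite /trunc.
by case: (boolP (x \in pool S n)) => [/ss' ->|_]; rewrite ?andbF.
Qed.

Lemma trunc_cvg s : trunc n s @[n --> \oo] --> s.
Proof.
apply: config_cvg => x.
exists (choice.pickle x).+1 => // n /= xn.
by rewrite /trunc in_pool xn andbT.
Qed.

(** Near any configuration the truncations are uniformly close to it, so
    compactness of the configuration space makes the truncation of a continuous
    function uniformly close to the function. *)
Lemma local_dense f : continuous f -> forall e : R, 0 < e ->
  exists A f', local_on A f' /\ forall s, `|f s - f' s| <= e.
Proof.
move=> cf e e0.
pose Pr n s := `|f s - f (trunc n s)| <= e.
have /compact_near_coveringP/(_ nat \oo Pr _) := config_compact.
case=> [s _|n _ hn]; last first.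
  exists (pool S n), (f \o trunc n); split; first exact: trunc_local.
  by move=> s; apply: (hn n (leqnn n) s).
have e2 : 0 < e / 2 by rewrite divr_gt0.
have c1 : \forall s' \near s & n \near \oo, `|f s - f s'| <= e / 2.
  have /cvgrPdist_le /(_ _ e2) h := cf s.
  by exists ([set s' | `|f s - f s'| <= e / 2], setT); [split => //; exact: filterT|move=> [s' n] /= []].
have c2 : \forall s' \near s & n \near \oo, `|f s - f (trunc n s')| <= e / 2.
  have tc : trunc z.2 z.1 @[z --> (nbhs s, \oo)] --> s.
    apply: config_cvg => x.
    exists ([set s' | s' x = s x], [set n | (choice.pickle x < n)%N]).
      by split; [exact: config_near|exists (choice.pickle x).+1].
    by move=> [s' n] /= [h1 h2]; rewrite /trunc in_pool h2 andbT.
  have h : f (trunc z.2 z.1) @[z --> (nbhs s, \oo)] --> f s.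
    exact: (cvg_comp _ _ tc (cf s)).
  have /cvgrPdist_le /(_ _ e2) := h; exact.
apply: filterS (filterI c1 c2) => -[s' n] /= [h1 h2]; rewrite /Pr.
rewrite (_ : f s' - _ = (f s - f (trunc n s')) - (f s - f s')); last by ring.
by apply: le_trans (ler_normB _ _) _; rewrite (splitr e); apply: lerD.
Qed.

Lemma local_bounded (A : {fset S}) f : local_on A f ->
  exists M : R, forall s, `|f s| <= M.
Proof.
move=> floc; pose ind (B : {fset S}) : config S := fun x => x \in B.
exists (\sum_(B <- fpowerset A) `|f (ind B)|) => s.
pose B := [fset x in A | s x]%fset.
have -> : f s = f (ind B).
  by apply: floc => x xA; rewrite /ind /B !inE xA.
have BA : B \in fpowerset A by rewrite fpowersetE; apply/fsubsetP => x; rewrite !inE => /andP[].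
by rewrite (big_rem B BA) /= lerDl; apply: sumr_ge0.
Qed.

Lemma continuous_bounded f : continuous f -> exists M : R, forall s, `|f s| <= M.
Proof.
move=> cf; have [A [f' [floc ff']]] := local_dense cf ltr01.
have [M hM] := local_bounded floc; exists (1 + M) => s.
by rewrite -(subrK (f' s) (f s)); apply: le_trans (ler_normD _ _) _; apply: lerD.
Qed.

Lemma uniform_nbhsP (f : {uniform config S -> R}) (Pr : set (config S -> R)) :
  nbhs f Pr <-> exists2 e : R, 0 < e & forall g, (forall s, `|f s - g s| <= e) -> Pr g.
Proof.
split=> [/uniform_nbhs[E [entE sub]]|[e e0 sub]].
  move: entE; rewrite -entourage_ballE => -[e /= e0 ballE].
  exists (e / 2); first by rewrite divr_gt0.
  move=> g fg; apply: sub => s _; apply: ballE => /=.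
  by apply: le_lt_trans (fg s) _; rewrite ltr_pdivrMr// ltr_pMr// ltr1n.
apply/uniform_nbhs; exists [set xy : R * R | ball xy.1 e xy.2]; split.
  exact: (entourage_ball _ (PosNum e0)).
by move=> g fg; apply: sub => s; exact/ltW/fg.
Qed.

End ConfigTopology.

(** * Short-time behaviour of iterated averages *)

Section Scheme.
Context (R : realType) (S : countType) (c : S -> S -> R).
Hypothesis c_ge0 : forall x y, 0 <= c x y.
Variables (Q : {fset S * S}) (h : R).
Hypothesis h_gt0 : 0 < h.
Implicit Types (s : config S) (g k : config S -> R).

Local Notation avg := (average Q (cell_rate c Q h)).
Local Notation C := (total c Q).
Local Notation damp := (expR (- (h * C))).

Lemma scheme_le i g (M : R) : (forall s, `|g s| <= M) -> forall s, `|iter i avg g s| <= M.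
Proof.
apply: iter_average_le => [p|]; first by apply: cell_rate_ge0 => //; exact: ltW.
by apply: sum_cell_rate_le1 => //; exact: ltW.
Qed.

Lemma schemeB i g g' s :
  iter i avg (fun s => g s - g' s) s = iter i avg g s - iter i avg g' s.
Proof.
have -> : (fun s => g s - g' s) = (fun s => g s + (-1) * g' s).
  by apply/funext => z; rewrite mulN1r.
by rewrite iter_averageD iter_averageZ mulN1r.
Qed.

Lemma scheme_dist i g g' (e : R) s : (forall s, `|g s - g' s| <= e) ->
  `|iter i avg g s - iter i avg g' s| <= e.
Proof. by move=> gg'; rewrite -schemeB; apply: scheme_le. Qed.

Lemma schemeS i g s :
  iter i.+1 avg g s = iter i avg g s + h * damp * iter i avg (gen_on Q c g) s.
Proof. by rewrite iterSr average_cell_rate iter_averageD iter_averageZ. Qed.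

Lemma damp_gt0 : 0 < damp. Proof. exact: expR_gt0. Qed.

Lemma damp_le1 : damp <= 1.
Proof. by rewrite -expR0 ler_expR oppr_le0 mulr_ge0 ?total_ge0// ltW. Qed.

Lemma damp_ge : 1 - h * C <= damp.
Proof. by have := expR_ge1Dx (- (h * C)). Qed.

Lemma scheme_small i g (G : R) s : (forall s, `|gen_on Q c g s| <= G) ->
  `|iter i avg g s - g s| <= i%:R * h * G.
Proof.
move=> gG; elim: i => [|i IH]; first by rewrite /= subrr normr0 !mul0r.
rewrite schemeS addrAC; apply: le_trans (ler_normD _ _) _.
rewrite -natr1 !mulrDl mul1r; apply: lerD => //.
rewrite !normrM (gtr0_norm h_gt0) (gtr0_norm damp_gt0) -mulrA ler_wpM2l ?(ltW h_gt0)//.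
apply: le_trans _ (scheme_le i gG s).
by rewrite ler_piMl// damp_le1.
Qed.

(** Each step adds [h * damp] times an iterate of [gen_on Q c f]. That iterate stays
    near [k] if [gen_on Q c f] is near [k] and if [k] has a bounded generator, so
    that the scheme moves [k] little. *)
Lemma scheme_derivative f k i n (a G M : R) s : (i <= n)%N ->
  (forall s, `|gen_on Q c f s - k s| <= a) ->
  (forall s, `|gen_on Q c k s| <= G) -> (forall s, `|k s| <= M) ->
  `|iter i avg f s - f s - i%:R * h * k s| <=
  i%:R * h * (a + n%:R * h * G + h * C * M).
Proof.
move=> + fa kG kM; elim: i => [|i IH] im.
  by rewrite /= subrr !mul0r subrr normr0.
have h0 := ltW h_gt0; have C0 : 0 <= C by exact: total_ge0.
have G0 : 0 <= G by apply: le_trans (kG s).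
have M0 : 0 <= M by apply: le_trans (kM s).
have a0 : 0 <= a by apply: le_trans (fa s).
rewrite schemeS.
have -> : iter i avg f s + h * damp * iter i avg (gen_on Q c f) s - f s - i.+1%:R * h * k s =
  (iter i avg f s - f s - i%:R * h * k s) +
  h * (damp * (iter i avg (gen_on Q c f) s - iter i avg k s) +
       damp * (iter i avg k s - k s) - (1 - damp) * k s).
  by rewrite -natr1; ring.
apply: le_trans (ler_normD _ _) _.
rewrite -[i.+1%:R]natr1 (mulrDl i%:R) mul1r (mulrDl (i%:R * h)); apply: lerD; first exact/IH/ltnW.
rewrite normrM (gtr0_norm h_gt0) ler_wpM2l//.
have d0 := damp_gt0; have d1 := damp_le1; have d2 := damp_ge.
apply: le_trans (ler_normB _ _) _; apply: lerD.
  apply: le_trans (ler_normD _ _) _; apply: lerD.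
    rewrite normrM (gtr0_norm d0); apply: (@le_trans _ _ (1 * a)); last by rewrite mul1r.
    by apply: ler_pM => //; exact: scheme_dist.
  rewrite normrM (gtr0_norm d0); apply: (@le_trans _ _ (1 * (n%:R * h * G))); last by rewrite mul1r.
  apply: ler_pM => //.
  apply: le_trans (scheme_small i s kG) _.
  by rewrite ler_wpM2r// ler_wpM2r// ler_nat ltnW.
rewrite normrM ger0_norm ?subr_ge0//; apply: ler_pM => //; first by rewrite subr_ge0.
by rewrite lerBlDr addrC -lerBlDr.
Qed.

(** The time average of the discrete evolution over [n] steps. *)
Definition scheme_mean n g : config S -> R :=
  fun s => n%:R^-1 * \sum_(i < n) iter i avg g s.

(** Each step changes the iterate by [h * damp] times its generator, and these changes
    telescope. *)
Lemma gen_scheme_mean n g s : (0 < n)%N ->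
  damp * gen_on Q c (scheme_mean n g) s = (iter n avg g s - g s) / (n%:R * h).
Proof.
move=> n0.
have nn : n%:R != 0 :> R by rewrite pnatr_eq0 -lt0n.
have hn : h != 0 by rewrite gt_eqF.
have step i : iter i.+1 avg g s - iter i avg g s =
    h * damp * gen_on Q c (iter i avg g) s.
  by rewrite iterS average_cell_rate addrAC subrr add0r.
have tele : iter n avg g s - g s = \sum_(i < n) h * damp * gen_on Q c (iter i avg g) s.
  under eq_bigr do rewrite -step.
  by rewrite -(big_mkord xpredT (fun i => iter i.+1 avg g s - iter i avg g s))
    telescope_sumr.
rewrite tele -mulr_sumr.
have -> : gen_on Q c (scheme_mean n g) s =
    n%:R^-1 * \sum_(i < n) gen_on Q c (iter i avg g) s.
  rewrite /gen_on [in RHS]exchange_big /= mulr_sumr; apply: eq_bigr => p _.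
  rewrite /scheme_mean -mulrBr -sumrB mulrCA; congr (_ * _).
  by rewrite mulr_sumr.
by field; rewrite nn hn.
Qed.

Lemma scheme_mean_dist n g (k e : R) s : (0 < n)%N ->
  (forall i, (i < n)%N -> `|iter i avg g s - k| <= e) ->
  `|scheme_mean n g s - k| <= e.
Proof.
move=> n0 he; have nn : 0 < n%:R :> R by rewrite ltr0n.
have -> : scheme_mean n g s - k = n%:R^-1 * \sum_(i < n) (iter i avg g s - k).
  rewrite sumrB big_const_ord iter_addr addr0 mulrBr -(mulr_natl k n) mulKf//.
  by rewrite gt_eqF.
rewrite normrM gtr0_norm ?invr_gt0// ler_pdivrMl//.
apply: le_trans (ler_norm_sum _ _ _) _.
apply: (@le_trans _ _ (\sum_(i < n) e)); first by apply: ler_sum => i _; exact: he.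
by rewrite big_const_ord iter_addr addr0 mulr_natl.
Qed.

Lemma scheme_mean_gradient n g (e : R) s s' : (0 < n)%N ->
  (forall i, (i < n)%N -> `|iter i avg g s - iter i avg g s'| <= e) ->
  `|scheme_mean n g s - scheme_mean n g s'| <= e.
Proof.
move=> n0 he; have nn : 0 < n%:R :> R by rewrite ltr0n.
rewrite /scheme_mean -mulrBr -sumrB normrM gtr0_norm ?invr_gt0// ler_pdivrMl//.
apply: le_trans (ler_norm_sum _ _ _) _.
apply: (@le_trans _ _ (\sum_(i < n) e)); first by apply: ler_sum => i _; exact: he.
by rewrite big_const_ord iter_addr addr0 mulr_natl.
Qed.

Lemma gen_on_local (A : {fset S}) g :
  (forall p, p \in Q -> p.1 \in A /\ p.2 \in A) -> local_on A g ->
  local_on A (gen_on Q c g) /\ local_on A (avg g).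
Proof.
move=> QA gl.
have hl p s s' : p \in Q -> (forall x, x \in A -> s x = s' x) -> g (hop p s) = g (hop p s').
  move=> /QA[p1 p2] ss'; apply: gl => x xA.
  exact: (@hop_local _ p s s' [set` A]).
split=> s s' ss'; rewrite /gen_on /average (gl _ _ ss'); last congr (_ + _).
  by rewrite !big_seq; apply: eq_bigr => p pQ; rewrite (hl _ _ _ pQ ss').
by rewrite !big_seq; apply: eq_bigr => p pQ; rewrite (hl _ _ _ pQ ss').
Qed.

Lemma scheme_mean_local (A : {fset S}) n g :
  (forall p, p \in Q -> p.1 \in A /\ p.2 \in A) -> local_on A g ->
  local_on A (scheme_mean n g).
Proof.
move=> QA gl.
have il i : local_on A (iter i avg g).
  by elim: i => //= i IH; exact: (gen_on_local QA IH).2.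
move=> s s' ss'; rewrite /scheme_mean; congr (_ * _).
by apply: eq_bigr => i _; exact: il.
Qed.

End Scheme.

(** * The generator and its core *)

Section Core.
Context d (Omega : measurableType d) (R : realType) (P : probability Omega R).
Context (S : countType) (c : S -> S -> R) (N : Omega -> S -> S -> R -> nat).
Hypothesis c_ge0 : forall x y, 0 <= c x y.
Hypothesis N_poisson : poisson_family P c N.
Variable t0 : R.
Hypothesis t0_gt0 : 0 < t0.
Hypothesis SEP : {ae P, forall w, finite_components t0 (N w) 0}.
Variable x0 : S.
Hypothesis rate_integrable : forall x,
  (\int[P]_(w in graphical_event N t0)
     (\esum_(z in influence_set t0 (N w) t0 x) total_rate c z) < +oo)%E.
Implicit Types (s : config S) (A : {fset S}) (f g k : config S -> R).

Local Notation sens := (sensitivity P N t0).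
Local Notation en := (energy P c N t0).
Local Notation gen n := (gen_on (pairs S n) c).
Local Notation St := (semigroup P N t0).

Definition energy_limit A : R := limn (en A).

Lemma energy_cvg A : en A n @[n --> \oo] --> energy_limit A.
Proof.
apply: nondecreasing_is_cvgn; first exact: energy_nondecreasing.
have [B hB] := energy_bounded c_ge0 N_poisson t0_gt0 SEP rate_integrable A.
by exists B => _ [n _ <-].
Qed.

Lemma energy_le A n : en A n <= energy_limit A.
Proof.
apply: nondecreasing_cvgn_le; first exact: energy_nondecreasing.
by apply/cvg_ex; eexists; exact: energy_cvg.
Qed.

Lemma energy_ge0 A n : 0 <= en A n.
Proof. by apply: sumr_ge0 => p _; rewrite mulr_ge0// sensitivity_ge0. Qed.

Lemma energy_limit_ge0 A : 0 <= energy_limit A.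
Proof. exact: le_trans (energy_ge0 A 0) (energy_le A 0). Qed.

Lemma energy_tail A (e : R) : 0 < e -> exists n0, forall n, (n0 <= n)%N ->
  energy_limit A - en A n <= e.
Proof.
move=> e0; have /cvgrPdist_le /(_ _ e0)[n0 _ h] := @energy_cvg A.
exists n0 => n /h /=; rewrite ger0_norm// subr_ge0; exact: energy_le.
Qed.

Definition steep A (a : R) g := forall s p, p.1 != p.2 -> `|g (hop p s) - g s| <= a * sens A p.

Definition full_gen g s : R := limn (fun n => gen n g s).

(** The pairs added between two truncations contribute at most their share of the
    energy. *)
Lemma gen_diff A a g s m n : 0 <= a -> steep A a g -> (m <= n)%N ->
  `|gen n g s - gen m g s| <= a * (en A n - en A m).
Proof.
move=> a0 sg mn; rewrite /gen_on /energy.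
have sub : {subset pairs S m <= pairs S n} by move=> p; exact: pairs_sub.
have split_sum (F : S * S -> R) : \sum_(p <- pairs S n) F p =
    \sum_(p <- pairs S m) F p + \sum_(p <- pairs S n | p \notin pairs S m) F p.
  rewrite (bigID (fun p => p \in pairs S m)) /=; congr (_ + _).
  rewrite -[LHS]big_filter; apply: perm_big; apply: uniq_perm.
  - by rewrite filter_uniq// fset_uniq.
  - exact: fset_uniq.
  - by move=> p; rewrite mem_filter; case: (boolP (p \in pairs S m)) => //= /sub ->.
rewrite !split_sum addrAC subrr add0r [X in _ * X]addrAC subrr add0r.
apply: le_trans (ler_norm_sum _ _ _) _; rewrite mulr_sumr.
rewrite big_seq_cond [leRHS]big_seq_cond; apply: ler_sum => p /andP[pn _].
rewrite normrM ger0_norm// mulrCA ler_wpM2l//.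
by apply: sg; exact: pairs_off pn.
Qed.

Lemma gen_bound A a g s n : 0 <= a -> steep A a g -> `|gen n g s| <= a * energy_limit A.
Proof.
move=> a0 sg; have p0 (F : S * S -> R) : \sum_(p <- pairs S 0) F p = 0.
  rewrite big_seq big1// => p; by rewrite in_pairs in_pool.
have := gen_diff s a0 sg (leq0n n); rewrite /gen_on /energy !p0 !subr0 => /le_trans; apply.
by rewrite ler_wpM2l//; exact: energy_le.
Qed.

(** Adding the energy of the truncation makes the sequence of truncated
    generators nondecreasing, which gives absolute convergence for free. *)
Lemma full_gen_cvg A a g s : 0 <= a -> steep A a g ->
  gen n g s @[n --> \oo] --> full_gen g s.
Proof.
move=> a0 sg.
pose v n := gen n g s + a * en A n.
have nd : nondecreasing_seq v.
  move=> m n mn; have := gen_diff s a0 sg mn.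
  by rewrite /v ler_norml => /andP[+ _]; lra.
have cv : cvgn v.
  apply: nondecreasing_is_cvgn => //.
  exists (a * energy_limit A + a * energy_limit A) => _ [n _ <-].
  apply: lerD; first by apply: le_trans (ler_norm _) _; exact: gen_bound.
  by rewrite ler_wpM2l// energy_le.
have ce : cvgn (fun n => a * en A n).
  by apply: is_cvgMr; apply/cvg_ex; eexists; exact: energy_cvg.
have E : (fun n => gen n g s) = (fun n => v n - a * en A n).
  by apply/funext => n; rewrite /v addrK.
have : cvgn (fun n => gen n g s) by rewrite E; exact: is_cvgB.
by [].
Qed.

Lemma full_gen_dist A a g s m : 0 <= a -> steep A a g ->
  `|full_gen g s - gen m g s| <= a * (energy_limit A - en A m).
Proof.
move=> a0 sg.
have cv : `|gen n g s - gen m g s| @[n --> \oo] --> `|full_gen g s - gen m g s|.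
  by apply: cvg_norm; apply: cvgB; [exact: full_gen_cvg sg|exact: cvg_cst].
rewrite -(cvg_lim _ cv)//; apply: limr_le; first by apply/cvg_ex; eexists; exact: cv.
exists m => // n /= mn; apply: le_trans (gen_diff s a0 sg mn) _.
by rewrite ler_wpM2l// lerD2r energy_le.
Qed.

Lemma scheme_steep A f (F : R) n i h : local_on A f -> (forall s, `|f s| <= F) ->
  0 < h -> i%:R * h <= t0 ->
  steep A (2 * F) (iter i (average (pairs S n) (cell_rate c (pairs S n) h)) f).
Proof.
move=> floc fF h0 ih s p _.
exact: (influence_bound c_ge0 N_poisson t0_gt0 SEP x0 s p (@pairs_off S n) h0 ih floc fF).
Qed.

Lemma local_steep A f (F : R) : local_on A f -> (forall s, `|f s| <= F) ->
  steep A (2 * F) f.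
Proof.
move=> floc fF; apply: (@scheme_steep A f F 0 0 t0) => //.
by rewrite mul0r ltW.
Qed.

Lemma bound_ge0 f (F : R) : (forall s, `|f s| <= F) -> 0 <= 2 * F.
Proof. by move=> fF; rewrite mulr_ge0//; apply: le_trans (fF point). Qed.

(** Local functions of the final configuration are measurable, and truncation makes
    continuous functions pointwise limits of local ones. *)
Lemma contraction g g' t (e : R) s : continuous g -> continuous g' ->
  0 < t -> t <= t0 -> (forall s, `|g s - g' s| <= e) -> `|St t g s - St t g' s| <= e.
Proof.
move=> cg cg' t_gt0 tt0 gg'.
have [M hM] := continuous_bounded cg; have [M' hM'] := continuous_bounded cg'.
apply: (semigroup_contraction c_ge0 N_poisson t0_gt0 SEP hM hM' _ t_gt0 tt0 gg').
move=> D mD mloc.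
have H f : continuous f -> measurable_fun D (fun w => f (eta t0 (N w) s t)).
  move=> cf; apply: (@measurable_fun_cvg _ _ _ _
    (fun n w => f (trunc n (eta t0 (N w) s t)))).
    by move=> n; apply: (mloc (pool S n) (f \o @trunc S n)); exact: trunc_local.
  move=> w _; exact: (cvg_comp _ _ (@trunc_cvg S (eta t0 (N w) s t)) (cf _)).
by split; exact: H.
Qed.

Lemma quotient_dist g g' t (e : R) s : continuous g -> continuous g' ->
  0 < t -> t <= t0 -> (forall s, `|g s - g' s| <= e * t) ->
  `|(St t g s - g s) / t - (St t g' s - g' s) / t| <= 2 * e.
Proof.
move=> cg cg' t_gt0 tt0 gg'.
rewrite -mulrBl normrM (gtr0_norm (_ : 0 < t^-1)) ?invr_gt0// ler_pdivrMr//.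
rewrite opprB addrACA [- g s + _]addrC -opprB.
have h1 := contraction s cg cg' t_gt0 tt0 gg'; have h2 := gg' s.
rewrite (_ : _ + _ = (St t g s - St t g' s) - (g s - g' s)); last by ring.
apply: le_trans (ler_normB _ _) _; lra.
Qed.

(** At a fixed small time [t], replace [f] by a local [f'] so close to it that the
    difference quotients stay close, and [g] by a local [k]. The quotient of [f'] is
    that of the scheme up to a small error, and [scheme_derivative] compares it with
    [k]. The approximation [f'] may depend on [t], but [k] may not. *)
Lemma generator_of_approx f g : continuous f -> continuous g ->
  (forall e : R, 0 < e -> exists A f', [/\ local_on A f',
     forall s, `|f s - f' s| <= e & forall s, `|full_gen f' s - g s| <= e]) ->
  generator P N t0 f g.
Proof.
move=> cf cg happ; split => //.
move=> Pr /uniform_nbhsP[e e0 hPr].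
(* The error [e] is made of nine parts: one from [g] to [k], six from the scheme
   started at [f'], two from replacing [f] by [f'] in the difference quotient. *)
pose b := e / 9; have b0 : 0 < b by rewrite divr_gt0.
have [B [k [kloc gk]]] := local_dense cg b0.
have [M kM] := local_bounded kloc.
have M2 := bound_ge0 kM.
pose G := 2 * M * energy_limit B.
have G0 : 0 <= G by rewrite mulr_ge0// energy_limit_ge0.
have kG n s : `|gen n k s| <= G by apply: gen_bound => //; exact: local_steep.
pose T := Num.min t0 (b / (G + 1)).
have T0 : 0 < T by rewrite lt_min t0_gt0 divr_gt0// ltr_wpDl.
suff : \forall t \near (0 : R)^'+, Pr (fun s => (St t f s - f s) / t) by [].
near=> t; apply: hPr => s.
have t_gt0 : 0 < t by near: t; exact: nbhs_right_gt.
have tT : t < T by near: t; exact: nbhs_right_lt.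
have tt0 : t <= t0 by apply: ltW; apply: lt_le_trans tT _; rewrite ge_min lexx.
have tG : t * G <= b.
  have : t <= b / (G + 1) by apply: ltW; apply: lt_le_trans tT _; rewrite ge_min lexx orbT.
  rewrite ler_pdivlMr; last by rewrite ltr_wpDl.
  by apply: le_trans; rewrite ler_wpM2l ?(ltW t_gt0)// lerDl.
pose e' := Num.min b (b * t).
have e'0 : 0 < e' by rewrite lt_min b0 mulr_gt0.
have [A [f' [floc ff' f'g]]] := happ e' e'0.
have [F fF] := local_bounded floc.
have F2 := bound_ge0 fF.
have cf' := local_continuous floc.
have q1 : `|(St t f s - f s) / t - (St t f' s - f' s) / t| <= 2 * b.
  apply: quotient_dist => // z; apply: le_trans (ff' z) _.
  by rewrite ge_min lexx orbT.
have bd0 : 0 < b / (2 * F + 1) by rewrite divr_gt0// ltr_wpDl.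
have [n1 hn1] := energy_tail A bd0.
have bt0 : 0 < b * t by rewrite mulr_gt0.
have [n2 hn2] := semigroup_scheme c_ge0 N_poisson t0_gt0 SEP x0 floc fF t_gt0 tt0 bt0.
pose n := maxn n1 n2.
have [m1 hm1] := hn2 n (leq_maxr _ _).
pose C := total c (pairs S n).
have C0 : 0 <= C by exact: total_ge0.
have M0 : 0 <= M by apply: le_trans (kM point).
pose m := maxn m1 (Num.truncn (t * C * M / b)).
have q2 := hm1 m (leq_maxl _ _) s.
pose h := t / m.+1%:R.
have h0 : 0 < h by rewrite divr_gt0.
have mh : m.+1%:R * h = t by rewrite /h mulrC divfK// pnatr_eq0.
have hCM : h * C * M <= b.
  have -> : h * C * M = t * C * M / m.+1%:R by rewrite /h; field; rewrite addrC natr1 pnatr_eq0.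
  rewrite ler_pdivrMr// [leRHS]mulrC -ler_pdivrMr//.
  apply: le_trans (ltW (truncnS_gt _)) _.
  by rewrite ler_nat ltnS leq_maxr.
have gen_f' z : `|gen n f' z - k z| <= 3 * b.
  have h1 := full_gen_dist z n F2 (local_steep floc fF).
  have h2 : 2 * F * (energy_limit A - en A n) <= b.
    have := hn1 n (leq_maxl _ _); rewrite ler_pdivlMr; last by rewrite ltr_wpDl.
    have : 0 <= energy_limit A - en A n by rewrite subr_ge0 energy_le.
    nra.
  have h3 : `|full_gen f' z - g z| <= b by apply: le_trans (f'g z) _; rewrite ge_min lexx.
  have h4 := gk z.
  rewrite (_ : _ - _ = (full_gen f' z - g z) + (g z - k z) - (full_gen f' z - gen n f' z)); last by ring.
  apply: le_trans (ler_normB _ _) _; apply: le_trans (lerD (ler_normD _ _) (lexx _)) _.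
  lra.
have q3 := scheme_derivative c_ge0 h0 s (leqnn m.+1) gen_f' (kG n) kM.
rewrite mh -/C in q3.
have q4 : `|(St t f' s - f' s) / t - k s| <= 6 * b.
  set it := iter _ _ _ _ in q2 q3.
  rewrite (_ : _ - k s = ((St t f' s - it) + (it - f' s - t * k s)) / t); last first.
    by field; rewrite gt_eqF.
  rewrite normrM (gtr0_norm (_ : 0 < t^-1)) ?invr_gt0// ler_pdivrMr//.
  apply: le_trans (ler_normD _ _) _.
  have : t * (3 * b + t * G + h * C * M) <= t * (3 * b + b + b).
    by rewrite ler_wpM2l ?(ltW t_gt0)// lerD// lerD2l.
  by move: q2 q3 => /=; rewrite -/it; nra.
rewrite (_ : g s - _ = (g s - k s) - ((St t f' s - f' s) / t - k s)
   - ((St t f s - f s) / t - (St t f' s - f' s) / t)); last by ring.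
have q5 := gk s.
apply: le_trans (ler_normB _ _) _; apply: le_trans (lerD (ler_normB _ _) (lexx _)) _.
have : e = 9 * b by rewrite /b; field.
lra.
Unshelve. all: by end_near. Qed.

Lemma full_gen_continuous A f : local_on A f -> continuous (full_gen f).
Proof.
move=> floc; have [F fF] := local_bounded floc; have F2 := bound_ge0 fF.
have st := local_steep floc fF.
move=> s; apply/cvgrPdist_le => e e0.
have bd0 : 0 < (e / 2) / (2 * F + 1) by rewrite !divr_gt0// ltr_wpDl.
have [n hn] := energy_tail A bd0.
pose B := (A `|` pool S n)%fset.
have QB p : p \in pairs S n -> p.1 \in B /\ p.2 \in B.
  by rewrite in_pairs => /and3P[h1 h2 _]; rewrite !in_fsetU h1 h2 !orbT.
have fB : local_on B f.
  by move=> z z' zz'; apply: floc => x xA; apply: zz'; rewrite in_fsetU xA.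
have genB := (gen_on_local c t0 QB fB).1.
have close z : `|full_gen f z - gen n f z| <= e / 2.
  apply: le_trans (full_gen_dist z n F2 st) _.
  have := hn n (leqnn n); rewrite ler_pdivlMr; last by rewrite ltr_wpDl.
  have : 0 <= energy_limit A - en A n by rewrite subr_ge0 energy_le.
  nra.
apply: filterS (config_near_fset B s) => s' /genB gs'.
rewrite (_ : _ - _ = (full_gen f s - gen n f s) - (full_gen f s' - gen n f s')); last first.
  by rewrite gs'; ring.
by apply: le_trans (ler_normB _ _) _; rewrite (splitr e); apply: lerD.
Qed.

(** The mean of the iterates over a short time [t] turns the increment quotient into
    a generator. Two local approximations of [g] are needed: [f1], chosen before [t],
    bounds how far the scheme moves in time [t]; [f], chosen after [t], is close to
    [g] at scale [t], so that dividing by [t] is harmless. *)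
Lemma approx_of_generator g k : generator P N t0 g k -> forall e : R, 0 < e ->
  exists A u, [/\ local_on A u, forall s, `|g s - u s| <= e &
    forall s, `|k s - full_gen u s| <= e].
Proof.
move=> [cg ck gk] e e0.
pose b := e / 6; have b0 : 0 < b by rewrite divr_gt0.
have [A1 [f1 [f1loc gf1]]] := local_dense cg b0.
have [F1 f1F] := local_bounded f1loc; have F12 := bound_ge0 f1F.
pose G := 2 * F1 * energy_limit A1.
have G0 : 0 <= G by rewrite mulr_ge0// energy_limit_ge0.
have f1G n s : `|gen n f1 s| <= G by apply: gen_bound => //; exact: local_steep.
pose T := Num.min t0 (b / (G + 1)).
have T0 : 0 < T by rewrite lt_min t0_gt0 divr_gt0// ltr_wpDl.
have : \forall t \near (0 : R)^'+, 0 < t /\ t < T /\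
    forall s, `|k s - (St t g s - g s) / t| <= b.
  near=> t; split; [|split]; near: t.
  - exact: nbhs_right_gt.
  - exact: nbhs_right_lt.
  - have /gk : nbhs (k : {uniform config S -> R})
        [set v : config S -> R | forall s, `|k s - v s| <= b].
      by apply/uniform_nbhsP; exists b.
    by [].
move=> /(@filter_ex _ _ (at_right_proper_filter (0 : R)))[t [t_gt0 [tT kt]]].
have tt0 : t <= t0 by apply: ltW; apply: lt_le_trans tT _; rewrite ge_min lexx.
have tG : t * G <= b.
  have : t <= b / (G + 1) by apply: ltW; apply: lt_le_trans tT _; rewrite ge_min lexx orbT.
  rewrite ler_pdivlMr; last by rewrite ltr_wpDl.
  by apply: le_trans; rewrite ler_wpM2l ?(ltW t_gt0)// lerDl.
pose e' := Num.min b (b * t).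
have bt0 : 0 < b * t by rewrite mulr_gt0.
have e'0 : 0 < e' by rewrite lt_min b0.
have [A [f [floc gf]]] := local_dense cg e'0.
have [F fF] := local_bounded floc; have F2 := bound_ge0 fF.
have cf := local_continuous floc.
have bd0 : 0 < b / (2 * F + 1) by rewrite divr_gt0// ltr_wpDl.
have [n1 hn1] := energy_tail A bd0.
have [n2 hn2] := semigroup_scheme c_ge0 N_poisson t0_gt0 SEP x0 floc fF t_gt0 tt0 bt0.
pose n := maxn n1 n2.
have [m1 hm1] := hn2 n (leq_maxr _ _).
pose C := total c (pairs S n).
have C0 : 0 <= C by exact: total_ge0.
(* [E] bounds [gen n u], and [m] makes the factor [exp (- h * C)] negligible against it. *)
pose E := 2 * F * energy_limit A.
have E0 : 0 <= E by rewrite mulr_ge0// energy_limit_ge0.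
pose m := maxn m1 (Num.truncn (t * C * E / b)).
pose h := t / m.+1%:R.
have h0 : 0 < h by rewrite divr_gt0.
have mh : m.+1%:R * h = t by rewrite /h mulrC divfK// pnatr_eq0.
have hCE : h * C * E <= b.
  have -> : h * C * E = t * C * E / m.+1%:R by rewrite /h; field; rewrite addrC natr1 pnatr_eq0.
  rewrite ler_pdivrMr// [leRHS]mulrC -ler_pdivrMr//.
  apply: le_trans (ltW (truncnS_gt _)) _.
  by rewrite ler_nat ltnS leq_maxr.
have it_le i : (i <= m.+1)%N -> i%:R * h <= t.
  by move=> im; rewrite -mh ler_wpM2r ?(ltW h0)// ler_nat.
pose B := (A `|` pool S n)%fset.
have QB p : p \in pairs S n -> p.1 \in B /\ p.2 \in B.
  by rewrite in_pairs => /and3P[h1 h2 _]; rewrite !in_fsetU h1 h2 !orbT.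
have fB : local_on B f.
  by move=> z z' zz'; apply: floc => x xA; apply: zz'; rewrite in_fsetU xA.
pose u := scheme_mean c (pairs S n) h m.+1 f.
exists B, u; split; first exact: scheme_mean_local.
- move=> s; rewrite distrC; apply: scheme_mean_dist => // i im.
  set it := iter i _.
  have d1 : `|it f s - it f1 s| <= b + b.
    apply: scheme_dist => // z.
    rewrite (_ : f z - f1 z = (g z - f1 z) - (g z - f z)); last by ring.
    apply: le_trans (ler_normB _ _) _; apply: lerD => //.
    by apply: le_trans (gf z) _; rewrite ge_min lexx.
  have d2 : `|it f1 s - f1 s| <= b.
    apply: le_trans (scheme_small c_ge0 h0 i s (f1G n)) _.
    by apply: le_trans tG; rewrite ler_wpM2r// it_le// ltnW.
  have d3 := gf1 s.
  rewrite (_ : it f s - g s = (it f s - it f1 s) + (it f1 s - f1 s) - (g s - f1 s)); last by ring.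
  apply: le_trans (ler_normB _ _) _; apply: le_trans (lerD (ler_normD _ _) (lexx _)) _.
  have : e = 6 * b by rewrite /b; field.
  lra.
move=> s.
have su : steep A (2 * F) u.
  move=> z p pne; apply: scheme_mean_gradient => // i im.
  by apply: scheme_steep => //; apply: le_trans tt0; rewrite it_le// ltnW.
have d1 : `|full_gen u s - gen n u s| <= b.
  apply: le_trans (full_gen_dist s n F2 su) _.
  have := hn1 n (leq_maxl _ _); rewrite ler_pdivlMr; last by rewrite ltr_wpDl.
  have : 0 <= energy_limit A - en A n by rewrite subr_ge0 energy_le.
  nra.
have d2 : `|gen n u s| <= E by exact: gen_bound.
have d3 := @gen_scheme_mean R S c (pairs S n) h h0 m.+1 f s (ltn0Sn m).
rewrite -/u mh -/C in d3.
have d4 : `|gen n u s - expR (- (h * C)) * gen n u s| <= b.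
  rewrite -{1}[gen n u s]mul1r -mulrBl normrM ger0_norm ?subr_ge0 ?damp_le1//.
  apply: le_trans hCE; apply: ler_pM => //; first by rewrite subr_ge0 damp_le1.
  by rewrite lerBlDr addrC -lerBlDr damp_ge.
have d5 : `|(St t f s - f s) / t - (iter m.+1 (average (pairs S n)
    (cell_rate c (pairs S n) h)) f s - f s) / t| <= b.
  rewrite -mulrBl normrM (gtr0_norm (_ : 0 < t^-1)) ?invr_gt0// ler_pdivrMr//.
  rewrite (_ : _ - _ = St t f s - iter m.+1 (average (pairs S n)
    (cell_rate c (pairs S n) h)) f s); last by ring.
  exact: (hm1 m (leq_maxl _ _) s).
have d6 : `|(St t g s - g s) / t - (St t f s - f s) / t| <= 2 * b.
  apply: quotient_dist => // z; apply: le_trans (gf z) _.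
  by rewrite ge_min lexx orbT.
have d7 := kt s.
rewrite -d3 in d5.
have eb : e = 6 * b by rewrite /b; field.
move: d1 d4 d5 d6 d7; rewrite !ler_norml.
move=> /andP[? ?] /andP[? ?] /andP[? ?] /andP[? ?] /andP[? ?].
by apply/andP; split; lra.
Unshelve. all: by end_near. Qed.

Lemma generator_unique f g g' : generator P N t0 f g -> generator P N t0 f g' -> g = g'.
Proof.
move=> [_ _ fg] [_ _ fg']; apply/funext => s; apply/eqP; rewrite -subr_eq0 -normr_eq0.
rewrite eq_le normr_ge0 andbT; apply/ler_addgt0Pr => e e0; rewrite add0r.
have e2 : 0 < e / 2 by rewrite divr_gt0.
have near_quotient k : (fun s => (St t f s - f s) / t) @[t --> 0^'+] -->
    (k : {uniform config S -> R}) ->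
    \forall t \near (0 : R)^'+, `|k s - (St t f s - f s) / t| <= e / 2.
  move=> fk.
  have H : \forall t \near (0 : R)^'+,
      forall s, `|k s - (St t f s - f s) / t| <= e / 2.
    have /fk : nbhs (k : {uniform config S -> R})
        [set v : config S -> R | forall s, `|k s - v s| <= e / 2].
      by apply/uniform_nbhsP; exists (e / 2).
    by [].
  by apply: filterS H => t /(_ s).
have [t [h1 h2]] := @filter_ex _ _ (at_right_proper_filter (0 : R)) _
  (filterI (near_quotient g fg) (near_quotient g' fg')).
rewrite (_ : g s - g' s = (g s - (St t f s - f s) / t) - (g' s - (St t f s - f s) / t));
  last by ring.
by apply: le_trans (ler_normB _ _) _; rewrite (splitr e); apply: lerD.
Qed.

Lemma local_generator A f : local_on A f -> generator P N t0 f (full_gen f).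
Proof.
move=> floc; apply: generator_of_approx.
- exact: local_continuous floc.
- exact: full_gen_continuous floc.
- by move=> e e0; exists A, f; split => // s; rewrite subrr normr0 ltW.
Qed.

End Core.

Theorem proposition5p14 (R : realType)
    (S : countType) (S_infinite : infinite_set [set: S])
    (c : S -> S -> R) (c_ge0 : forall x y, 0 <= c x y)
    (c_diag : forall x, c x x = 0)
    (d : measure_display) (Omega : measurableType d) (P : probability Omega R)
    (N : Omega -> S -> S -> R -> nat) (N_poisson : poisson_family P c N)
    (t0 : R) (t0_gt0 : 0 < t0)
    (SEP : {ae P, forall w, finite_components t0 (N w) 0})
    (card_integrable : forall (x : S) (t : R), 0 <= t ->
      (\int[P]_(w in graphical_event N t0)
         counting (influence_set t0 (N w) t x) < +oo)%E)
    (rate_integrable : forall (x : S) (t : R), 0 <= t ->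
      (\int[P]_(w in graphical_event N t0)
         (\esum_(z in influence_set t0 (N w) t x) total_rate c z) < +oo)%E) :
  is_core (generator P N t0) (@local_functions R S).
Proof.
have [x0 _] : exists x0 : S, True.
  apply: contrapT => noS; apply: S_infinite; rewrite (_ : [set: S] = set0)//.
  by rewrite -subset0 => x _; apply: noS; exists x.
have rate x := rate_integrable x t0 (ltW t0_gt0).
have Lloc := local_generator c_ge0 N_poisson t0_gt0 SEP x0 rate.
split=> [f [A floc]|]; first by exists (full_gen c f); exact: Lloc floc.
apply/seteqP; split=> [[f g] /= fg|[f g] /= [cl [cf cg]]].
  split; last by case: fg.
  move=> B [[B1 B2] /= [/uniform_nbhsP[e1 e1_gt0 hB1] /uniform_nbhsP[e2 e2_gt0 hB2]] sub].
  have e_gt0 : 0 < Num.min e1 e2 by rewrite lt_min e1_gt0.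
  have [A [u [uloc fu gu]]] :=
    approx_of_generator c_ge0 N_poisson t0_gt0 SEP x0 rate fg e_gt0.
  exists (u, full_gen c u); split; first by split; [exists A|exact: Lloc uloc].
  apply: sub; split => /=.
    by apply: hB1 => s; apply: le_trans (fu s) _; rewrite ge_min lexx.
  by apply: hB2 => s; apply: le_trans (gu s) _; rewrite ge_min lexx orbT.
apply: (generator_of_approx c_ge0 N_poisson t0_gt0 SEP x0 rate) => // e e_gt0.
have nf : nbhs (f : {uniform config S -> R}) [set u : config S -> R | forall s, `|f s - u s| <= e].
  by apply/uniform_nbhsP; exists e.
have ng : nbhs (g : {uniform config S -> R}) [set u : config S -> R | forall s, `|g s - u s| <= e].
  by apply/uniform_nbhsP; exists e.
have [[f' g'] /= [[[A f'loc] f'g'] [ff' gg']]] := cl (_ `*` _) (ex_intro2 _ _ (_, _) (conj nf ng) (@subset_refl _ _)).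
exists A, f'; split => // s.
by rewrite distrC (generator_unique (Lloc A f' f'loc) f'g').
Qed.
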